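(* Let $\Delta$ be a simplicial complex on $X=\{x_1,\dots,x_n\}$, let $\alpha=(k_1,\dots,k_n)$ be a vector of positive integers, and let $K$ be a field. Put $S=K[x_1,\dots,x_n]$ and $S^\alpha=K[x_{ij}: 1\le i\le n,\ 1\le j\le k_i]$. Let $J_\Delta\subseteq S$ denote the Alexander dual of the facet ideal $I(\Delta)$, and let $J_{\Delta^\alpha}\subseteq S^\alpha$ denote the Alexander dual of the facet ideal $I(\Delta^\alpha)$ of the expansion $\Delta^\alpha$. Then: (i) $\beta_i(S/J_\Delta)=\beta_i(S^\alpha/J_{\Delta^\alpha})$ for all $i$, where $\beta_i$ denotes the $i$-th total Betti number (over $S$ and $S^\alpha$, respectively); (ii) $S/J_\Delta$ is Cohen-Macaulay if and only if $S^\alpha/J_{\Delta^\alpha}$ is Cohen-Macaulay.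
   Context: Simplicial complexes are finite and contain the empty face; $\mathcal F(\Delta)$ is the set of facets (maximal faces) of $\Delta$. Expansion: for $\alpha=(k_1,\dots,k_n)$ put $X^\alpha=\{x_{ij}: 1\le i\le n,\ 1\le j\le k_i\}$. The expansion $\Delta^\alpha$ is the simplicial complex on $X^\alpha$ whose facets are the sets $\{x_{i_1j_1},\dots,x_{i_rj_r}\}$ with $\{x_{i_1},\dots,x_{i_r}\}\in\mathcal F(\Delta)$ (distinct $i_1,\dots,i_r$) and $1\le j_m\le k_{i_m}$ for all $m$. Facet ideal: for a complex $\Gamma$ on a set of variables, $I(\Gamma)=(x^F: F\in\mathcal F(\Gamma))$ with $x^F=\prod_{x\in F}x$, in the polynomial ring over $K$ on all these variables. Its Alexander dual is $J_\Gamma=I(\Gamma)^\vee=\bigcap_{F\in\mathcal F(\Gamma)}P_F$, where $P_F=(x: x\in F)$ is the ideal generated by the variables in $F$. *)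

(* Defs.v *)
From Stdlib Require Import ClassicalEpsilon.
From mathcomp Require Import all_boot all_algebra.
From mathcomp Require Import mpoly.

Set Implicit Arguments.
Unset Strict Implicit.
Unset Printing Implicit Defensive.

Import GRing.Theory.
Local Open Scope ring_scope.

(** * Simplicial complexes and expansions *)

(* Not every vertex of [V] is required to be a face. *)
Definition is_complex (V : finType) (D : {set {set V}}) : Prop :=
  set0 \in D /\ (forall F G : {set V}, F \in D -> G \subset F -> G \in D).

Definition facets (V : finType) (D : {set {set V}}) : {set {set V}} :=
  [set F | maxset (mem D) F].

(* [Tagged _ j : expvar k], with tag [i], is the variable x_{ij}; the second
   index runs over 0..k_i - 1. *)
Definition expvar (n : nat) (k : 'I_n -> nat) : finType := {i : 'I_n & 'I_(k i)}.

Definition expansion_facets (n : nat) (k : 'I_n -> nat) (D : {set {set 'I_n}}) :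
    {set {set expvar k}} :=
  [set G : {set expvar k} |
    dinjectiveb tag G && ([set tag x | x in G] \in facets D)].

Definition expansion (n : nat) (k : 'I_n -> nat) (D : {set {set 'I_n}}) :
    {set {set expvar k}} :=
  [set H : {set expvar k} | [exists G in expansion_facets k D, H \subset G]].

Lemma expansion_is_complex (n : nat) (k : 'I_n -> nat) (D : {set {set 'I_n}}) :
  (forall i, 0 < k i)%N -> is_complex D -> is_complex (expansion k D).
Proof.
move=> k_gt0 [D0 _]; split=> [|F G].
  have [F maxF _] := maxset_exists (D0 : mem D set0).
  pose u i : expvar k := Tagged (fun i => 'I_(k i)) (Ordinal (k_gt0 i)).
  have uK : cancel u tag by [].
  rewrite inE; apply/existsP; exists (u @: F); rewrite sub0set andbT inE.
  apply/andP; split.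
    by apply/dinjectiveP=> x y /imsetP[i _ ->] /imsetP[j _ ->]; rewrite !uK => ->.
  by rewrite -imset_comp (eq_imset _ uK) imset_id inE.
rewrite !inE => /existsP[E /andP[EE sFE]] sGF.
by apply/existsP; exists E; rewrite EE (subset_trans sGF).
Qed.

Lemma facets_expansion (n : nat) (k : 'I_n -> nat) (D : {set {set 'I_n}}) :
  facets (expansion k D) = expansion_facets k D.
Proof.
apply/setP=> G; rewrite [LHS]inE; apply/maxsetP/idP => [[]|EG].
  rewrite /= inE => /existsP[E /andP[EE sGE]] maxG.
  suff -> : G = E by [].
  by apply/esym/maxG=> //=; rewrite inE; apply/existsP; exists E; rewrite EE /=.
split=> [|H]; first by rewrite /= inE; apply/existsP; exists G; rewrite EG /=.
rewrite /= inE => /existsP[E /andP[]].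
move: EG; rewrite !inE => /andP[_ /maxsetP[_ maxG]] /andP[/dinjectiveP injE].
move=> /maxsetP[DE _] sHE sGH; have sGE := subset_trans sGH sHE.
have eqGE : [set tag x | x in E] = [set tag x | x in G].
  by apply: maxG => //; apply: imsetS.
apply/eqP; rewrite eqEsubset sGH andbT; apply/subsetP => x Hx.
have Ex := subsetP sHE x Hx.
have /imsetP[y Gy exy] : tag x \in [set tag x | x in G].
  by rewrite -eqGE; apply: imset_f.
by rewrite (injE x y Ex (subsetP sGE y Gy) exy).
Qed.

(** * Ideals, as Prop-valued predicates *)

Definition ideal_gen (R : comNzRingType) (s : seq R) (p : R) : Prop :=
  exists c : 'I_(size s) -> R, p = \sum_(i < size s) c i * s`_i.

Definition ideal_add (R : comNzRingType) (I J : R -> Prop) (p : R) : Prop :=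
  exists a b, [/\ I a, J b & p = a + b].

(* The polynomial ring on the variables [v : V] is [{mpoly K[#|V|]}]. *)
Definition var (K : fieldType) (V : finType) (v : V) : {mpoly K[#|V|]} :=
  'X_(enum_rank v).

Definition var_ideal (K : fieldType) (V : finType) (F : {set V}) :
    {mpoly K[#|V|]} -> Prop :=
  ideal_gen [seq var K v | v <- enum F].

(* J_D, the Alexander dual of the facet ideal I(D) = (x^F : F a facet of D):
   the intersection of the ideals P_F over the facets F. *)
Definition facet_ideal_dual (K : fieldType) (V : finType) (D : {set {set V}})
    (p : {mpoly K[#|V|]}) : Prop :=
  forall F : {set V}, F \in facets D -> var_ideal F p.

Definition irrelevant_ideal (K : fieldType) (n : nat) (p : {mpoly K[n]}) : Prop :=
  p@_0%MM = 0.

(** * Betti numbers of S/J, for S = K[x_1..x_n] and J a homogeneous ideal *)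

(* A minimal graded free resolution
     ... -> F_2 -> F_1 -> F_0 -> S/J -> 0,   F_i = \bigoplus_a S(- deg i a),
   where F_i has rank [r i].  Elements of F_i are row vectors, the differential
   F_{i+1} -> F_i is right multiplication by [d i], and F_0 -> S/J is right
   multiplication by [aug] followed by the projection S -> S/J.  By minimality
   the generators have degrees >= 0, so [deg] may take values in [nat]. *)
Record minimal_graded_resolution (K : fieldType) (n : nat)
    (J : {mpoly K[n]} -> Prop) (r : nat -> nat)
    (deg : forall i, 'I_(r i) -> nat)
    (aug : 'cV[{mpoly K[n]}]_(r 0%N))
    (d : forall i, 'M[{mpoly K[n]}]_(r i.+1, r i)) : Prop := {
  mgr_aug_homog : forall a, aug a 0 \is (deg 0%N a).-homog;
  mgr_homog : forall i a b, d i a b = 0 \/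
    exists2 e, deg i.+1 a = (deg i b + e)%N & d i a b \is e.-homog;
  mgr_surj : forall p, exists v : 'rV_(r 0%N), J (p - (v *m aug) 0 0);
  mgr_exact0 : forall v : 'rV_(r 0%N),
    J ((v *m aug) 0 0) <-> exists w, v = w *m d 0%N;
  mgr_exact : forall i (v : 'rV_(r i.+1)),
    v *m d i = 0 <-> exists w, v = w *m d i.+1;
  mgr_minimal : forall i a b, irrelevant_ideal (d i a b) }.

Definition has_betti (K : fieldType) (n : nat) (J : {mpoly K[n]} -> Prop)
    (i b : nat) : Prop :=
  exists r deg aug d, @minimal_graded_resolution K n J r deg aug d /\ r i = b.

(* The total Betti number beta_i(S/J); for J homogeneous, the b such that
   [has_betti J i b] exists and is unique. *)
Definition betti (K : fieldType) (n : nat) (J : {mpoly K[n]} -> Prop)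
    (i : nat) : nat :=
  epsilon (inhabits 0%N) (has_betti J i).

(** * Cohen-Macaulay quotients *)

Definition regular_sequence (R : comNzRingType) (J : R -> Prop) (f : seq R) :
    Prop :=
  (forall i p, (i < size f)%N ->
     ideal_add J (ideal_gen (take i f)) (f`_i * p) ->
     ideal_add J (ideal_gen (take i f)) p)
  /\ ~ ideal_add J (ideal_gen f) 1.

(* depth S/J = t: the maximal length of an (S/J)-regular sequence in
   m = (x_1..x_n). *)
Definition has_depth (K : fieldType) (n : nat) (J : {mpoly K[n]} -> Prop)
    (t : nat) : Prop :=
  let msequence f :=
    regular_sequence J f /\ (forall p, p \in f -> irrelevant_ideal p) in
  (exists2 f, msequence f & size f = t) /\
  (forall f, msequence f -> (size f <= t)%N).

(* A chain P_0 < ... < P_l of prime ideals containing J, i.e. of prime ideals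
   of R/J; [idealr_closed] includes properness. *)
Definition prime_chain (R : comNzRingType) (J : R -> Prop) (l : nat)
    (P : nat -> {pred R}) : Prop :=
  [/\ forall i, (i <= l)%N -> idealr_closed (P i) /\ prime_idealr_closed (P i),
      forall p, J p -> p \in P 0%N &
      forall i, (i < l)%N -> {subset P i <= P i.+1} /\
        exists2 p, p \in P i.+1 & p \notin P i].

Definition has_krull_dim (R : comNzRingType) (J : R -> Prop) (t : nat) : Prop :=
  (exists P, prime_chain J t P) /\
  (forall l P, prime_chain J l P -> (l <= t)%N).

Definition cohen_macaulay (K : fieldType) (n : nat) (J : {mpoly K[n]} -> Prop) :
    Prop :=
  exists2 t, has_depth J t & has_krull_dim J t.

(* Main.v *)
(* Write u_i for the product of the x_ij over j.  A choice of one x_ij for each i in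
   a facet F gives a facet of the expansion, and the intersection of the primes so
   obtained from F is (u_i : i in F).  Hence J_{Delta^alpha} is the extension of
   J_Delta along x_i |-> u_i, which makes S^alpha a free S-module on the monomials
   divisible by no u_i.  Therefore base change carries a minimal free resolution of
   S/J_Delta to one of S^alpha/J_{Delta^alpha}.  The result is not homogeneous for
   the standard grading, but ranks of minimal resolutions are unique even among
   ungraded ones, which gives (i).

   For (ii), both quotients have codimension h, the least size of a facet of Delta.
   By the Auslander-Buchsbaum argument (mapping cones, and the syzygy theorem), a
   regular sequence of length N - h (N the number of variables) exists exactly when
   the minimal resolution vanishes beyond degree h, and this condition is the same
   on both sides. *)

Require Import Defs.
From Stdlib Require Import ClassicalEpsilon.
From HB Require Import structures.
From mathcomp Require Import all_boot all_algebra.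
From mathcomp Require Import mpoly zify ssrcomplements.

Set Implicit Arguments.
Unset Strict Implicit.
Unset Printing Implicit Defensive.

Import GRing.Theory.
Local Open Scope ring_scope.

(** * Noetherianity of polynomial rings *)

(** Resolutions and regular sequences meet as follows. The cone over a regular element lengthens a
    minimal resolution by one step, and no minimal resolution is longer than N, so the length of a
    resolution plus that of a regular sequence is at most N. Conversely, if the irrelevant ideal
    consists of zero-divisors modulo J, then S/J has a nonzero element killed by all variables, and
    this forces a nonzero rank in degree N; so a resolution of length below N always leaves room for
    one more regular element.

    The upper bound d = N - h on the dimension is a count that serves prime chains and regular
    sequences alike. A chain of length s gives B^s products of its witnesses, independent over K
    modulo J and of degree O(B), while only O(b^d) monomials of degree at most b lie outside J. For
    s = d + 1 and B large the two are incompatible. *)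

Lemma choice_fun (A B : Type) (P : A -> B -> Prop) :
  (forall x, exists y, P x y) -> exists f : A -> B, forall x, P x (f x).
Proof.
move=> h; exists (fun x => proj1_sig (constructive_indefinite_description _ (h x))).
by move=> x; case: constructive_indefinite_description.
Qed.

Lemma in_spanP (R : pzRingType) (k m r : nat) (M : 'M[R]_(k, r)) (G : 'M[R]_(m, r)) :
  (forall i, exists w, row i M = w *m G) -> exists W, M = W *m G.
Proof.
case/choice_fun=> f fP; exists (\matrix_i f i).
by apply/row_matrixP=> i; rewrite row_mul rowK.
Qed.

Definition is_ideal (R : comNzRingType) (I : R -> Prop) : Prop :=
  [/\ I 0, forall a b, I a -> I b -> I (a + b) & forall c a, I a -> I (c * a)].

Definition is_submod (R : comNzRingType) (r : nat) (N : 'rV[R]_r -> Prop) : Prop :=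
  [/\ N 0, forall u v, N u -> N v -> N (u + v) & forall c v, N v -> N (c *: v)].

Definition spanned (R : comNzRingType) (r k : nat) (N : 'rV[R]_r -> Prop)
    (G : 'M[R]_(k, r)) : Prop :=
  forall v, N v <-> exists w : 'rV_k, v = w *m G.

(** Stated for submodules of free modules rather than ideals, because resolutions need finitely
    generated syzygies. *)
Definition noetherian (R : comNzRingType) : Prop :=
  forall r (N : 'rV[R]_r -> Prop), is_submod N ->
    exists k (G : 'M[R]_(k, r)), spanned N G.

Section Submod.
Variables (R : comNzRingType) (r : nat).
Implicit Types (N : 'rV[R]_r -> Prop).

Lemma submod_sum N (I : finType) (F : I -> 'rV[R]_r) :
  is_submod N -> (forall i, N (F i)) -> N (\sum_i F i).
Proof. by case=> N0 ND _ NF; elim/big_ind: _. Qed.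

Lemma submodB N u v : is_submod N -> N u -> N v -> N (u - v).
Proof. by case=> N0 ND NZ Nu Nv; apply: ND => //; rewrite -scaleN1r; apply: NZ. Qed.

Lemma submod_mul N k (w : 'rV[R]_k) (G : 'M[R]_(k, r)) :
  is_submod N -> (forall i, N (row i G)) -> N (w *m G).
Proof.
move=> sN NG; rewrite mulmx_sum_row; apply: submod_sum => // i.
by case: sN => _ _; apply.
Qed.

Lemma spannedP N k (G : 'M[R]_(k, r)) : is_submod N ->
  (forall i, N (row i G)) -> (forall v, N v -> exists w : 'rV_k, v = w *m G) ->
  spanned N G.
Proof. by move=> sN NG h v; split=> [/h//|[w ->]]; apply: submod_mul. Qed.

Lemma spanned_row N k (G : 'M[R]_(k, r)) i : spanned N G -> N (row i G).
Proof. by move=> h; apply/h; exists (delta_mx 0 i); rewrite rowE. Qed.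

End Submod.

Lemma submod_ker (R : comNzRingType) r s (d : 'M[R]_(r, s)) :
  is_submod (fun v : 'rV_r => v *m d = 0).
Proof.
split=> [|u v hu hv|c v hv]; first exact: mul0mx.
  by rewrite mulmxDl hu hv addr0.
by rewrite -scalemxAl hv scaler0.
Qed.

Lemma idealB (R : comNzRingType) (I : R -> Prop) a b :
  is_ideal I -> I a -> I b -> I (a - b).
Proof. by case=> _ ID IM Ia Ib; apply: ID => //; rewrite -mulN1r; apply: IM. Qed.

Lemma ideal_sum (R : comNzRingType) (I : R -> Prop) (T : finType) (F : T -> R) :
  is_ideal I -> (forall i, I (F i)) -> I (\sum_i F i).
Proof. by case=> I0 ID _ IF; elim/big_ind: _. Qed.

(** Induction on the rank: the first coordinates of [N] form an ideal, and the vectors of [N] with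
    first coordinate 0 form a submodule of smaller rank. Lifts of generators of the former ([G1])
    and generators of the latter ([G2]) generate [N]. *)
Lemma noetherian_ideals (R : comNzRingType) :
  (forall I : R -> Prop, is_ideal I ->
     exists k (g : 'cV[R]_k), (forall i, I (g i 0)) /\
       forall p, I p -> exists w : 'rV_k, p = (w *m g) 0 0) ->
  noetherian R.
Proof.
move=> fgI; elim=> [|r IHr]; last rewrite -[r.+1]/(1 + r)%N; move=> N sN.
  exists 0%N, 0; apply: spannedP => // [[]//|v _].
  by exists 0; rewrite [LHS]thinmx0 [RHS]thinmx0.
case: (sN) => N0 ND NZ.
pose mk (a : R) (u : 'rV[R]_r) : 'rV_(1 + r) := row_mx a%:M u.
have mkD a b u v : mk a u + mk b v = mk (a + b) (u + v).
  by rewrite /mk add_row_mx raddfD.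
have mkZ c a u : c *: mk a u = mk (c * a) (c *: u).
  by rewrite /mk scale_row_mx scale_scalar_mx.
have mk0 : mk 0 0 = 0 by rewrite /mk raddf0 row_mx0.
have mkE (v : 'rV[R]_(1 + r)) : v = mk (lsubmx v 0 0) (rsubmx v).
  rewrite /mk -[LHS](@hsubmxK _ 1 1 r); congr row_mx.
  exact: mx11_scalar.
pose I a := exists u, N (mk a u).
have iI : is_ideal I.
  split=> [|a b [u Nu] [v Nv]|c a [u Nu]].
  - by exists 0; rewrite mk0.
  - by exists (u + v); rewrite -mkD; apply: ND.
  - by exists (c *: u); rewrite -mkZ; apply: NZ.
have [k [g [Ig fg]]] := fgI _ iI.
have [U NU] := choice_fun Ig.
have sN0 : is_submod (fun u => N (mk 0 u)).
  split=> [|u v Nu Nv|c u Nu]; first by rewrite mk0.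
    by rewrite -[0]addr0 -mkD; apply: ND.
  by rewrite -(mulr0 c) -mkZ; apply: NZ.
have [m [G sG]] := IHr _ sN0.
have mkM j (w : 'rV_j) (a : 'cV_j) (M : 'M_(j, r)) :
    w *m (row_mx a M : 'M_(j, 1 + r)) = mk ((w *m a) 0 0) (w *m M).
  by rewrite /mk -mx11_scalar; apply: mul_mx_row.
pose G1 : 'M_(k, 1 + r) := row_mx g (\matrix_i U i).
pose G2 : 'M_(m, 1 + r) := row_mx (0 : 'cV_m) G.
exists (k + m)%N, (col_mx G1 G2).
have NG1 (w : 'rV_k) : N (w *m G1).
  apply: submod_mul => // i.
  rewrite rowE mkM -!rowE rowK.
  by rewrite (_ : row i g 0 0 = g i 0) ?mxE.
apply: spannedP => // [i|v Nv].
  case: (split_ordP i) => j ->; rewrite ?rowKu ?rowKd; first by rewrite rowE.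
  by rewrite rowE mkM mulmx0 -rowE mxE; apply: (spanned_row j sG).
have [w def_a] : exists w : 'rV_k, lsubmx v 0 0 = (w *m g) 0 0.
  by apply: fg; exists (rsubmx v); rewrite -mkE.
have [w' def_u] : exists w' : 'rV_m,
    rsubmx v - w *m \matrix_i U i = w' *m G.
  apply/sG; have := submodB sN Nv (NG1 w).
  rewrite mkM {1}(mkE v) def_a -scaleN1r mkZ mkD mulN1r subrr scaleN1r.
  by [].
exists (row_mx w w'); rewrite mul_row_col !mkM mulmx0 [X in _ + mk X _]mxE mkD addr0.
by rewrite -def_u addrC subrK -def_a -mkE.
Qed.

Lemma noetherian_ideal_gen (R : comNzRingType) (I : R -> Prop) :
  noetherian R -> is_ideal I ->
  exists k (g : 'cV[R]_k), (forall i, I (g i 0)) /\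
    forall p, I p -> exists w : 'rV_k, p = (w *m g) 0 0.
Proof.
move=> nR [I0 ID IM]; pose N (v : 'rV[R]_1) := I (v 0 0).
have sN : is_submod N.
  by split=> [|u v|c v]; rewrite /N mxE //; [apply: ID | apply: IM].
have [k [g sg]] := nR _ _ sN; exists k, g; split=> [i|p Ip].
  by have := spanned_row i sg; rewrite /N mxE.
have [|w Dw] := (sg p%:M).1; first by rewrite /N mxE eqxx.
by exists w; rewrite -Dw mxE eqxx.
Qed.

Lemma field_noetherian (K : fieldType) : noetherian K.
Proof.
apply: noetherian_ideals => I [I0 _ IM].
case: (excluded_middle_informative (I 1)) => [I1|nI1].
  exists 1%N, 1; split=> [i|p _]; first by rewrite ord1 mxE.
  by exists p%:M; rewrite mulmx1 mxE.
exists 0%N, 0; split=> [[]//|p Ip]; exists 0.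
rewrite mulmx0 mxE; case: (eqVneq p 0) => [-> //|nz_p].
by case: nI1; rewrite -(mulVf nz_p); apply: IM.
Qed.

Lemma noetherian_surj (R S : comNzRingType) (f : {rmorphism R -> S}) :
  (forall y, exists x, f x = y) -> noetherian R -> noetherian S.
Proof.
move=> surj_f nR; apply: noetherian_ideals => I [I0 ID IM].
have iI : is_ideal (fun x => I (f x)).
  split=> [|a b|c a]; first by rewrite rmorph0.
    by rewrite rmorphD; apply: ID.
  by rewrite rmorphM; apply: IM.
have [k [g [Ig fg]]] := noetherian_ideal_gen nR iI.
exists k, (map_mx f g); split=> [i|p]; first by rewrite mxE.
have [x <-] := surj_f p; case/fg=> w ->.
by exists (map_mx f w); rewrite -map_mxM [RHS]mxE.
Qed.

(* The degrees are made uniform: the ideal [L] of leading coefficients has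
   generators which are the coefficients in degree [D] of some [q i] of degree at
   most [D], and reduction by the [q i] brings every element below degree [D]. *)
Lemma poly_noetherian (R : comNzRingType) : noetherian R -> noetherian {poly R}.
Proof.
move=> nR; apply: noetherian_ideals => I iI; have [I0 ID IM] := iI.
pose L (a : R) := exists p d, [/\ I p, (size p <= d.+1)%N & p`_d = a].
have shift (p : {poly R}) d e : (size p <= d.+1)%N ->
    (size ('X^e * p)%R <= (e + d).+1)%N /\ ('X^e * p)`_(e + d) = p`_d.
  move=> hp; split; last by rewrite coefXnM ltnNge leq_addr addKn.
  by apply: leq_trans (size_polyMleq _ _) _; rewrite size_polyXn /= -addnS leq_add2l.
have iL : is_ideal L.
  split=> [|a b [p [d [Ip szp <-]]] [q [e [Iq szq <-]]]|c a [p [d [Ip szp <-]]]].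
  - by exists 0, 0%N; rewrite size_poly0 coef0.
  - have [sz1 c1] := shift _ _ e szp; have [sz2 c2] := shift _ _ d szq.
    exists ('X^e * p + 'X^d * q), (e + d)%N; split.
    + by apply: ID; apply: IM.
    + by rewrite (leq_trans (size_polyD _ _)) // geq_max sz1 addnC sz2.
    + by rewrite coefD c1 [in X in _ + X]addnC c2.
  - exists (c%:P * p), d; split; first exact: IM.
    + by rewrite mul_polyC (leq_trans (size_scale_leq _ _)).
    + by rewrite coefCM.
have [k [a [La fgL]]] := noetherian_ideal_gen nR iL.
have [p Pp] := choice_fun La; have [d Pd] := choice_fun Pp.
pose D := (\max_i d i)%N; pose q i := 'X^(D - d i) * p i.
have dD i : (D - d i + d i = D)%N by rewrite subnK // /D (leq_bigmax i).
have Iq i : I (q i) by apply: IM; case: (Pd i).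
have szq i : (size (q i) <= D.+1)%N.
  by have [_ szp _] := Pd i; have [+ _] := shift _ _ (D - d i)%N szp; rewrite dD.
have cq i : (q i)`_D = a i 0.
  have [_ szp <-] := Pd i; have [_ +] := shift _ _ (D - d i)%N szp.
  by rewrite dD.
have red e (f : {poly R}) : I f -> (size f <= D + e)%N ->
    exists w : 'I_k -> {poly R}, (size (f - \sum_i w i * q i)%R <= D)%N.
  elim: e f => [|e IHe] f If szf.
    rewrite addn0 in szf; exists (fun _ => 0).
    by rewrite big1 ?subr0 // => i _; rewrite mul0r.
  have [|w0 Dw0] := fgL (f`_(D + e)).
    by exists f, (D + e)%N; rewrite -addnS.
  pose g := f - \sum_i ((w0 0 i)%:P * 'X^e) * q i.
  have Ig : I g.
    by apply: idealB => //; apply: ideal_sum => // i; apply: IM.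
  have szX i : (size ((w0 0 i)%:P * 'X^e * q i)%R <= (D + e).+1)%N.
    have [h _] := shift _ _ e (szq i).
    by rewrite -mulrA mul_polyC addnC (leq_trans (size_scale_leq _ _)).
  have szg : (size g <= D + e)%N.
    apply/leq_sizeP=> j; rewrite leq_eqVlt => /predU1P[<-|ltj].
      rewrite coefB coef_sum Dw0 mxE -sumrB big1 // => i _.
      rewrite -cq -mulrA coefCM addnC.
      by have [_ ->] := shift _ _ e (szq i); rewrite subrr.
    rewrite coefB coef_sum nth_default ?(leq_trans szf) ?addnS // sub0r.
    by rewrite big1 ?oppr0 // => i _; apply: nth_default; apply: leq_trans (szX i) _.
  have [w szw] := IHe g Ig szg.
  exists (fun i => (w0 0 i)%:P * 'X^e + w i); apply: leq_trans szw.
  rewrite /g -addrA -opprD -big_split /=.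
  by under eq_bigr do rewrite mulrDl.
(* Remainders of size at most [D] are vectors in R^D, where the hypothesis on submodules supplies
   the missing generators. *)
pose N (v : 'rV[R]_D) := I (rVpoly v).
have sN : is_submod N.
  split=> [|u v|c v]; rewrite /N; first by rewrite linear0.
    by rewrite linearD; apply: ID.
  by rewrite linearZ /= -mul_polyC; apply: IM.
have [m [G sG]] := nR _ _ sN.
exists (k + m)%N, (col_mx (\col_i q i) (\col_i rVpoly (row i G))).
split=> [i|f If].
  by case: (split_ordP i) => j ->; rewrite ?col_mxEu ?col_mxEd mxE //;
     apply: (spanned_row j sG).
have [w szw] := red (size f) f If (leq_addl _ _).
set g := f - _ in szw.
have [|w' Dw'] := (sG (poly_rV g)).1.
  rewrite /N poly_rV_K //.
  by apply: idealB => //; apply: ideal_sum => // i; apply: IM.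
exists (row_mx (\row_i w i) (map_mx polyC w')).
rewrite mul_row_col mxE !mxE -[LHS](subrK (\sum_i w i * q i)) -/g addrC.
congr (_ + _); last by apply: eq_bigr => i _; rewrite !mxE.
rewrite -(poly_rV_K szw) Dw' mulmx_sum_row linear_sum.
by apply: eq_bigr => i _; rewrite !mxE linearZ /= mul_polyC.
Qed.

Section MpolyNoetherian.
Variable K : fieldType.

Lemma widen_split n (m : 'X_{1..n.+1}) :
  m = (mnmwiden [multinom m (widen_ord (leqnSn n) i) | i < n] +
       U_(ord_max) *+ m ord_max)%MM.
Proof.
apply/mnmP=> i; rewrite mnmDE mulmnE mnm1E.
case: (unliftP ord_max i) => [j ->|->]; last by rewrite mnmwiden_ordmax eqxx mul1n.
have -> : lift ord_max j = widen_ord (leqnSn n) j.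
  by apply/val_inj; rewrite /= /bump leqNgt ltn_ord.
by rewrite mnmwiden_widen mnmE -val_eqE /= gtn_eqF ?addn0.
Qed.

Lemma mpolyX_widen n (m : 'X_{1..n.+1}) : exists m' : 'X_{1..n},
  'X_[m] = mwiden 'X_[m'] * 'X_ord_max ^+ m ord_max :> {mpoly K[n.+1]}.
Proof.
exists [multinom m (widen_ord (leqnSn n) i) | i < n].
by rewrite {1}(widen_split m) mpolyXD mwidenX mpolyXn.
Qed.

Lemma mpoly_noetherian n : noetherian {mpoly K[n]}.
Proof.
elim: n => [|n IHn].
  apply: (@noetherian_surj K _ (@mpolyC 0 K)) (@field_noetherian K) => p.
  by exists p@_0%MM; apply: esym (nvar0_mpolyC p).
pose h := horner_eval ('X_ord_max : {mpoly K[n.+1]}) \o map_poly (@mwiden n K).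
apply: (@noetherian_surj _ _ h) (poly_noetherian IHn) => p.
elim/mpolyind: p => [|c m p _ _ [q <-]]; first by exists 0; rewrite rmorph0.
have [m' Dm] := mpolyX_widen m.
exists ((c *: 'X_[m'])%:P * 'X^(m ord_max) + q); rewrite rmorphD; congr (_ + _).
rewrite /h /= /horner_eval rmorphM /= map_polyC map_polyXn hornerM hornerC hornerXn.
by rewrite Dm /= mwidenZ scalerAl.
Qed.

End MpolyNoetherian.

(** * Minimal free resolutions, without grading *)

(** Exactness in positive degrees: the complex resolves the cokernel of [d 0%N], whatever that
    is. *)
Definition exact_cx (R : comNzRingType) (r : nat -> nat)
    (d : forall i, 'M[R]_(r i.+1, r i)) : Prop :=
  forall i (v : 'rV_(r i.+1)), v *m d i = 0 <-> exists w, v = w *m d i.+1.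

Section Complex.
Variables (R : comNzRingType) (r : nat -> nat) (d : forall i, 'M[R]_(r i.+1, r i)).
Hypothesis ed : exact_cx d.

Lemma exact_cx_comp i : d i.+1 *m d i = 0.
Proof.
by apply/row_matrixP=> j; rewrite row_mul row0; apply/ed; exists (delta_mx 0 j); rewrite rowE.
Qed.

Lemma exact_cx_mx i k (M : 'M_(k, r i.+1)) :
  M *m d i = 0 -> exists W, M = W *m d i.+1.
Proof.
by move=> Md; apply: in_spanP => j; apply/ed; rewrite -row_mul Md row0.
Qed.

End Complex.

Notation ct_mx := (map_mx (mcoeff 0%MM)).

Definition minimal_cx (K : fieldType) (n : nat) (r : nat -> nat)
    (d : forall i, 'M[{mpoly K[n]}]_(r i.+1, r i)) : Prop :=
  forall i, ct_mx (d i) = 0.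

(* [A] and [B] are the bottom degrees of comparison maps; [A *m B] is homotopic
   to the identity, [E] being the part of the homotopy coming from below, and this
   shape is preserved when both complexes are shifted by one. *)
Lemma homotopy_rank_le (K : fieldType) (n : nat) (i : nat) (r r' : nat -> nat)
    (d : forall i, 'M[{mpoly K[n]}]_(r i.+1, r i))
    (d' : forall i, 'M[{mpoly K[n]}]_(r' i.+1, r' i)) (A : 'M_(r 0%N, r' 0%N))
    (B : 'M_(r' 0%N, r 0%N)) (H : 'M_(r 0%N, r 1%N)) (E : 'M_(r 0%N)) A1 B1 :
  exact_cx d -> minimal_cx d -> exact_cx d' ->
  A *m B = 1%:M + H *m d 0%N + E -> d 0%N *m E = 0 -> ct_mx E = 0 ->
  d 0%N *m A = A1 *m d' 0%N -> d' 0%N *m B = B1 *m d 0%N ->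
  (r i <= r' i)%N.
Proof.
elim: i r r' d d' A B H E A1 B1 => [|i IHi] r r' d d' A B H E A1 B1 ed md ed'.
  (* Constant terms turn the homotopy relation into A B = 1 over K, which bounds the rank. *)
  move=> DAB _ E0 _ _; apply: (@mulmx1_min _ _ _ (ct_mx A) (ct_mx B)).
  by rewrite -map_mxM DAB !map_mxD map_mx1 map_mxM md mulmx0 E0 !addr0.
move=> DAB dE _ DA DB.
have [H1 DH1] : exists W, A1 *m B1 - 1%:M - d 0%N *m H = W *m d 1%N.
  apply: exact_cx_mx => //.
  rewrite !mulmxBl -[A1 *m B1 *m _]mulmxA -DB mulmxA -DA -mulmxA DAB !mulmxDr.
  by rewrite mul1mx mulmx1 dE addr0 mulmxA -addrA -opprD subrr.
have [A2 DA2] : exists W, d 1%N *m A1 = W *m d' 1%N.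
  by apply: exact_cx_mx => //; rewrite -mulmxA -DA mulmxA exact_cx_comp ?mul0mx.
have [B2 DB2] : exists W, d' 1%N *m B1 = W *m d 1%N.
  by apply: exact_cx_mx => //; rewrite -mulmxA -DB mulmxA exact_cx_comp ?mul0mx.
(* In the shifted complexes the part from below is [d 0%N *m H]: [d 1%N] kills it, and minimality
   removes its constant terms. *)
apply: (IHi (r \o succn) (r' \o succn) (fun j => d j.+1) (fun j => d' j.+1)
  A1 B1 H1 (d 0%N *m H) A2 B2) => //=.
- by move=> j v; apply: ed.
- by move=> j; apply: md.
- by move=> j v; apply: ed'.
- by rewrite -DH1 -addrA subrK addrC subrK.
- by rewrite mulmxA exact_cx_comp ?mul0mx.
- by rewrite map_mxM md mul0mx.
Qed.

Record resolution (K : fieldType) (n : nat) (J : {mpoly K[n]} -> Prop)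
    (r : nat -> nat) (aug : 'cV[{mpoly K[n]}]_(r 0%N))
    (d : forall i, 'M[{mpoly K[n]}]_(r i.+1, r i)) : Prop := Resolution {
  res_surj : forall p, exists v : 'rV_(r 0%N), J (p - (v *m aug) 0 0);
  res_exact0 : forall v : 'rV_(r 0%N),
    J ((v *m aug) 0 0) <-> exists w, v = w *m d 0%N;
  res_exact : exact_cx d;
  res_minimal : minimal_cx d }.

Lemma mgr_resolution (K : fieldType) (n : nat) (J : {mpoly K[n]} -> Prop) r deg aug d :
  @minimal_graded_resolution K n J r deg aug d -> resolution J aug d.
Proof.
case=> _ _ surj ex0 ex min; split=> // i.
by apply/matrixP=> a b; rewrite !mxE; apply: min.
Qed.

Section Uniqueness.
Variables (K : fieldType) (n : nat) (J : {mpoly K[n]} -> Prop).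
Hypothesis iJ : is_ideal J.

Lemma ideal_mulmx k m (M : 'M_(k, m)) (c : 'cV_m) :
  (forall a, J (c a 0)) -> forall a, J ((M *m c) a 0).
Proof.
by move=> Jc a; rewrite mxE; apply: ideal_sum => // j; case: iJ => _ _; apply.
Qed.

Lemma res_exact0_mx r aug d k (M : 'M_(k, r 0%N)) :
  @resolution K n J r aug d ->
  (forall a, J ((M *m aug) a 0)) <-> exists W, M = W *m d 0%N.
Proof.
case=> _ ex0 _ _; split=> [JM|[W ->] a].
  apply: in_spanP => j; apply/ex0; rewrite -row_mul mxE; exact: JM.
have -> : (W *m d 0%N *m aug) a 0 = (row a (W *m d 0%N) *m aug) 0 0.
  by rewrite -row_mul [RHS]mxE.
by apply/ex0; exists (row a W); rewrite row_mul.
Qed.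

Lemma res_surj_mx r aug d k (c : 'cV_k) : @resolution K n J r aug d ->
  exists A : 'M_(k, r 0%N), forall a, J ((c - A *m aug) a 0).
Proof.
case=> surj _ _ _; have [f fP] := choice_fun (fun a => surj (c a 0)).
exists (\matrix_a f a) => a.
by have := fP a; rewrite !mxE; under [in X in _ -> X]eq_bigr do rewrite mxE.
Qed.

(** [A] and [B] lift the identity of S/J, so [A *m B - 1%:M] maps into J and factors through
    [d 0%N]; the homotopy starts with [E] equal to 0. *)
Lemma resolution_rank_le r aug d r' aug' d' i :
  @resolution K n J r aug d -> @resolution K n J r' aug' d' -> (r i <= r' i)%N.
Proof.
move=> F F'.
have [A JA] := res_surj_mx aug F'; have [B JB] := res_surj_mx aug' F.
have J0 r0 aug0 d0 (F0 : @resolution K n J r0 aug0 d0) a : J ((d0 0%N *m aug0) a 0).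
  by move: a; apply/(res_exact0_mx _ F0); exists 1%:M; rewrite mul1mx.
have mxDJ k (u v : 'cV_k) :
    (forall a, J (u a 0)) -> (forall a, J (v a 0)) -> forall a, J ((u + v) a 0).
  by move=> Ju Jv a; rewrite mxE; case: iJ => _ + _; apply.
have mxNJ k (u : 'cV_k) : (forall a, J (u a 0)) -> forall a, J ((- u) a 0).
  by move=> Ju a; rewrite mxE -mulN1r; case: iJ => _ _; apply.
have comm r1 aug1 d1 r2 aug2 d2 M : @resolution K n J r1 aug1 d1 ->
    @resolution K n J r2 aug2 d2 -> (forall a, J ((aug1 - M *m aug2) a 0)) ->
    exists W, d1 0%N *m M = W *m d2 0%N.
  move=> F1 F2 JM; apply/(res_exact0_mx _ F2).
  rewrite -mulmxA -[M *m _](subKr aug1) mulmxBr.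
  by apply: (mxDJ) => //; [apply: J0 | apply: mxNJ; apply: ideal_mulmx].
have [A1 DA] := comm _ _ _ _ _ _ _ F F' JA.
have [B1 DB] := comm _ _ _ _ _ _ _ F' F JB.
have [H DH] : exists W, A *m B - 1%:M = W *m d 0%N.
  apply/(res_exact0_mx _ F).
  have -> : (A *m B - 1%:M) *m aug = - (A *m (aug' - B *m aug)) - (aug - A *m aug').
    by rewrite mulmxBl mul1mx mulmxBr !opprB mulmxA addrA subrK.
  by apply: (mxDJ); apply: mxNJ => //; apply: ideal_mulmx.
apply: (@homotopy_rank_le _ _ _ _ _ d d' A B H 0 A1 B1) => //; try by case: F; case: F'.
- by rewrite -DH addr0 addrC subrK.
- by rewrite mulmx0.
- by rewrite map_mx0.
Qed.

Lemma resolution_rank_eq r aug d r' aug' d' i :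
  @resolution K n J r aug d -> @resolution K n J r' aug' d' -> r i = r' i.
Proof.
move=> F F'; apply/eqP.
by rewrite eqn_leq (resolution_rank_le i F F') (resolution_rank_le i F' F).
Qed.

End Uniqueness.

(** * Existence of minimal graded free resolutions *)

Lemma ex_min_nat (P : nat -> Prop) :
  (exists k, P k) -> exists2 k, P k & forall j, P j -> (k <= j)%N.
Proof.
case=> k Pk; apply: NNPP => nP; elim/ltn_ind: k Pk => k IHk Pk.
apply: nP; exists k => // j Pj; rewrite leqNgt; apply/negP=> ltjk.
exact: IHk ltjk Pj.
Qed.

Section Graded.
Variables (K : fieldType) (n : nat).
Local Notation S := {mpoly K[n]}.

Lemma pihomogM j c (p q : S) : q \is c.-homog ->
  pihomog mdeg j (p * q) = if (c <= j)%N then pihomog mdeg (j - c) p * q else 0.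
Proof.
move=> hq; elim/mpolyind: p => [|x m p _ _ IHp].
  by rewrite mul0r !linear0 mul0r if_same.
rewrite mulrDl !linearD /= IHp mulrDl -!scalerAl !linearZ /= pihomogX.
have hm : 'X_[m] * q \is (mdeg m + c).-homog by apply: dhomogM => //; rewrite dhomogX.
have -> : pihomog mdeg j ('X_[m] * q) =
    if (mdeg m + c == j)%N then 'X_[m] * q else 0.
  case: eqP => [<-|/eqP ne]; first exact: pihomog_dE.
  exact: pihomog_ne0 ne hm.
case: leqP => [lecj|ltjc].
  have -> : (mdeg m == j - c)%N = (mdeg m + c == j)%N.
    by rewrite -(eqn_add2r c) subnK.
  by case: eqP => _; rewrite ?scaler0 ?mul0r // scalerAl.
rewrite ifN ?scaler0 ?addr0 //; apply/eqP => Dj.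
by move: ltjc; rewrite -Dj ltnNge leq_addl.
Qed.

Definition hmatrix (k r : nat) (deg' : 'I_k -> nat) (deg : 'I_r -> nat)
    (d : 'M[S]_(k, r)) : Prop :=
  forall a b, d a b = 0 \/
    exists2 e, deg' a = (deg b + e)%N & d a b \is e.-homog.

(** The component of degree [e] in the direct sum of the S(-deg a). The test guards against
    truncated subtraction, which would return a constant term when [deg a] exceeds [e]. *)
Definition hcomp (r : nat) (deg : 'I_r -> nat) (e : nat) (v : 'rV[S]_r) : 'rV[S]_r :=
  \row_a (if (deg a <= e)%N then pihomog mdeg (e - deg a) (v 0 a) else 0).

Lemma hcomp_mul k r deg' deg d e (v : 'rV_k) : @hmatrix k r deg' deg d ->
  hcomp deg e (v *m d) = hcomp deg' e v *m d.
Proof.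
move=> hd; apply/rowP=> b; rewrite !mxE linear_sum /=.
transitivity (\sum_a (if (deg b <= e)%N then pihomog mdeg (e - deg b) (v 0 a * d a b) else 0)).
  by case: leqP => _ //; rewrite big1.
apply: eq_bigr => a _; rewrite mxE.
case: (hd a b) => [->|[c Dc hc]]; first by rewrite !mulr0 linear0 if_same.
rewrite (pihomogM _ _ hc) Dc; case: leqP => [le|lt].
  by rewrite leq_subRL // subnDA; case: ifP; rewrite ?mul0r.
by rewrite leqNgt (leq_trans lt) ?leq_addr // mul0r.
Qed.

Lemma hcomp0 r deg e : @hcomp r deg e 0 = 0.
Proof. by apply/rowP=> a; rewrite !mxE linear0 if_same. Qed.

Lemma hcomp_sum r deg (v : 'rV[S]_r) E : (forall a, deg a + msize (v 0%R a) <= E)%N ->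
  v = \sum_(e < E) hcomp deg e v.
Proof.
move=> leE; apply/rowP=> a; rewrite summxE.
have [k DE] : exists k, E = (deg a + k)%N.
  by exists (E - deg a)%N; rewrite subnKC // (leq_trans _ (leE a)) ?leq_addr.
have lek : (msize (v 0%R a) <= k)%N by rewrite -(leq_add2l (deg a)) -DE.
rewrite (pihomog_partitionE lek) -(big_mkord xpredT (fun e => hcomp deg e v 0 a)) DE.
rewrite (big_cat_nat (n := deg a)) ?leq_addr //= [X in _ = X + _]big_nat_cond.
rewrite [X in _ = X + _]big1 ?add0r; last first.
  by move=> e /andP[/andP[_ lte] _]; rewrite mxE leqNgt lte.
rewrite -{1}[deg a]add0n [(deg a + k)%N]addnC big_addn addnK big_mkord.
by apply: eq_bigr => e _; rewrite mxE leq_addl addnK.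
Qed.

Definition graded r (deg : 'I_r -> nat) (N : 'rV[S]_r -> Prop) : Prop :=
  forall e v, N v -> N (hcomp deg e v).

Lemma ker_graded k r deg' deg d : @hmatrix k r deg' deg d ->
  graded deg' (fun v => v *m d = 0).
Proof. by move=> hd e v v0; rewrite -(hcomp_mul _ _ hd) v0 hcomp0. Qed.

(** The homogeneous components of finitely many generators stay in [N] since it is graded, and still
    generate it; [E] bounds their degrees. *)
Lemma homog_generators r (deg : 'I_r -> nat) (N : 'rV[S]_r -> Prop) :
  is_submod N -> graded deg N ->
  exists k (deg' : 'I_k -> nat) (G : 'M_(k, r)), hmatrix deg' deg G /\ spanned N G.
Proof.
move=> sN gN; have [k [G sG]] := @mpoly_noetherian K n r N sN.
pose E := (\max_i \max_a (deg a + msize (G i a)))%N.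
pose T : finType := ('I_k * 'I_E)%type; pose h (x : T) := hcomp deg x.2 (row x.1 G).
exists #|T|, (fun j => val (enum_val j).2), (\matrix_(j < #|T|) h (enum_val j)); split.
  move=> j b; rewrite !mxE; case: leqP => [le|_]; [right | by left].
  by exists ((enum_val j).2 - deg b)%N; rewrite ?subnKC ?pihomogP.
apply: spannedP => // [j|v /sG[w ->]].
  by rewrite rowK; apply: gN; apply: spanned_row sG.
suff [W DW] : exists W, G = W *m \matrix_(j < #|T|) h (enum_val j).
  by exists (w *m W); rewrite {1}DW mulmxA.
apply: in_spanP => i.
have leE a : (deg a + msize (row i G 0%R a) <= E)%N.
  rewrite mxE; apply: leq_trans (leq_bigmax (F := fun i => \max_a _)%N i).
  exact: (leq_bigmax (F := fun a => deg a + msize (G i a))%N a).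
exists (\row_j ((enum_val j).1 == i)%:R); rewrite mulmx_sum_row {1}(hcomp_sum leE).
under [RHS]eq_bigr do rewrite mxE rowK.
rewrite (reindex (@enum_rank T)) /=; last first.
  by exists enum_val => x _; rewrite ?enum_rankK ?enum_valK.
under [RHS]eq_bigr do rewrite enum_rankK.
rewrite -(pair_bigA _ (fun i' e => (i' == i)%:R *: h (i', e))) /=.
rewrite (bigD1 i) //= [X in _ + X]big1 ?addr0 => [|i' ne].
  by apply: eq_bigr => e _; rewrite eqxx scale1r.
by rewrite big1 // => e _; rewrite (negbTE ne) scale0r.
Qed.

(** Graded Nakayama: take the fewest homogeneous generators. A relation with nonzero constant term
    at [a], cut down to degree [deg' a], has a nonzero scalar as coefficient there, so generator [a]
    could be dropped. *)
Lemma min_generators r (deg : 'I_r -> nat) (N : 'rV[S]_r -> Prop) :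
  is_submod N -> graded deg N ->
  exists k (deg' : 'I_k -> nat) (G : 'M_(k, r)), [/\ hmatrix deg' deg G, spanned N G &
    forall v : 'rV_k, v *m G = 0 -> forall a, (v 0 a)@_0%MM = 0].
Proof.
move=> sN gN.
have [k [deg' [G [hG sG]]] mink] := ex_min_nat (homog_generators sN gN).
exists k, deg', G; split=> // v vG a; apply/eqP/negPn/negP=> nz.
case: k deg' G hG sG mink v vG a nz => [|k] deg' G hG sG mink v vG a nz.
  by case: a {nz}.
pose u := hcomp deg' (deg' a) v.
have uG : u *m G = 0 by rewrite -(hcomp_mul _ _ hG) vG hcomp0.
have ua : u 0 a = ((v 0 a)@_0%MM)%:MP.
  rewrite mxE leqnn subnn.
  have h0 : pihomog mdeg 0 (v 0 a) \is 0.-homog by apply: pihomogP.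
  have D0 : (pihomog mdeg 0 (v 0 a))@_0%MM = (v 0 a)@_0%MM.
    elim/mpolyind: (v 0 a) => [|c m p _ _ IHp]; first by rewrite linear0.
    rewrite linearD /= linearZ /= pihomogX !mcoeffD IHp; congr (_ + _).
    rewrite mdeg_eq0 -!mul_mpolyC !mcoeffCM mcoeffX.
    by case: eqP; rewrite ?mcoeff0 // => ->; rewrite mcoeffX eqxx.
  rewrite -D0; apply/mpolyP=> m; rewrite mcoeffC.
  case: eqP => [->|/eqP nm]; rewrite ?mulr1 // mulr0.
  by apply: (dhomog_nemf_coeff h0); rewrite mdeg_eq0.
suff : (k.+1 <= k)%N by rewrite ltnn.
apply: mink; exists (deg' \o lift a), (row' a G); split.
  by move=> i b; rewrite !mxE; apply: hG.
have rowa : exists w, row a G = w *m row' a G.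
  exists (\row_i (- ((v 0 a)@_0%MM)^-1 *: u 0 (lift a i))).
  rewrite mulmx_sum_row.
  have := uG; rewrite mulmx_sum_row (bigD1_ord a) //= ua => /eqP.
  rewrite addr_eq0 => /eqP Da.
  have -> : row a G = (((v 0 a)@_0%MM)^-1)%:MP *: (((v 0 a)@_0%MM)%:MP *: row a G).
    by rewrite scalerA -mpolyCM mulVf // mpolyC1 scale1r.
  rewrite Da scalerN scaler_sumr -sumrN; apply: eq_bigr => i _.
  by rewrite row_rowsub [X in _ = X *: _]mxE scalerA scaleNr scaleNr -mul_mpolyC.
apply: spannedP => // [i|w /sG[z ->]].
  by rewrite row_rowsub; apply: (spanned_row _ sG).
suff [W DW] : exists W, G = W *m row' a G.
  by exists (z *m W); rewrite {1}DW mulmxA.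
apply: in_spanP => i; case: (unliftP a i) => [j ->|-> //].
by exists (delta_mx 0 j); rewrite -rowE row_rowsub.
Qed.

Record graded_module := GradedModule {
  gm_rank : nat;
  gm_deg : 'I_gm_rank -> nat;
  gm_mem : 'rV[S]_gm_rank -> Prop;
  gm_submod : is_submod gm_mem;
  gm_graded : graded gm_deg gm_mem }.

Record generated (N : graded_module) := Generated {
  gn_rank : nat;
  gn_deg : 'I_gn_rank -> nat;
  gn_mx : 'M[S]_(gn_rank, gm_rank N);
  gn_homog : hmatrix gn_deg (@gm_deg N) gn_mx;
  gn_span : spanned (@gm_mem N) gn_mx;
  gn_min : forall v : 'rV_gn_rank, v *m gn_mx = 0 -> forall a, (v 0 a)@_0%MM = 0 }.

(** Generators are chosen as data so that taking syzygies becomes a function that can be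
    iterated. *)
Lemma generate (N : graded_module) : generated N.
Proof.
have h := min_generators (@gm_submod N) (@gm_graded N).
have [k h1] := constructive_indefinite_description _ h.
have [deg' h2] := constructive_indefinite_description _ h1.
have [G [hG sG mG]] := constructive_indefinite_description _ h2.
exact: Generated hG sG mG.
Qed.

Definition syzygy_module (N : graded_module) : graded_module :=
  GradedModule (submod_ker (gn_mx (generate N))) (ker_graded (@gn_homog _ (generate N))).

Lemma graded_resolution_exists (J : S -> Prop) : is_ideal J ->
  (forall p, J p -> irrelevant_ideal p) ->
  (forall e p, J p -> J (pihomog mdeg e p)) ->
  exists r deg aug d, @minimal_graded_resolution K n J r deg aug d.
Proof.
move=> iJ Jm hJ; have [J0 JD JM] := iJ.
pose N0 (v : 'rV[S]_1) := J (v 0 0).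
have sN0 : is_submod N0.
  by split=> [|u v|c v]; rewrite /N0 mxE //; [apply: JD | apply: JM].
have gN0 : graded (fun _ => 0%N) N0.
  by move=> e v; rewrite /N0 mxE leq0n subn0; apply: hJ.
pose M i := iter i syzygy_module (GradedModule sN0 gN0).
exists (fun i => gm_rank (M i)), (fun i => @gm_deg (M i)), 1, (fun i => gn_mx (generate (M i))).
split.
- by move=> a; rewrite mxE ord1 eqxx dhomog1.
- by move=> i; apply: gn_homog.
- by move=> p; exists p%:M; rewrite mulmx1 mxE eqxx subrr.
- by move=> v; rewrite mulmx1; apply: (@gn_span _ (generate (M 0%N))).
- by move=> i v; apply: (@gn_span _ (generate (M i.+1))).
(* The rows of [d 0%N] are elements of J, hence without constant term; later rows are relations
   among minimal generators. *)
- case=> [|i] a b.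
    have := spanned_row a (@gn_span _ (generate (M 0%N))).
    by rewrite /= /N0 mxE ord1; apply: Jm.
  have := spanned_row a (@gn_span _ (generate (M i.+1))).
  by move/gn_min/(_ b); rewrite mxE.
Qed.

End Graded.

(** * Hilbert's syzygy theorem for minimal resolutions *)

Section LastVariable.
Variables (K : fieldType) (n : nat).

Local Notation X := ('X_ord_max : {mpoly K[n.+1]}).
Local Notation wid := (widen_ord (leqnSn n)).

Definition kill_last : {mpoly K[n.+1]} -> {mpoly K[n]} :=
  mmap (@mpolyC n K) (fun i => if unlift ord_max i is Some j then 'X_j else 0).

HB.instance Definition _ := GRing.RMorphism.on kill_last.

Lemma lift_max (j : 'I_n) : lift ord_max j = wid j.
Proof. by apply/val_inj; rewrite /= /bump leqNgt ltn_ord. Qed.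

Lemma kill_lastX : kill_last X = 0.
Proof. by rewrite /kill_last mmapX mmap1U unlift_none. Qed.

Lemma kill_last_widX j : kill_last 'X_(wid j) = 'X_j.
Proof. by rewrite /kill_last mmapX mmap1U -lift_max liftK. Qed.

Lemma kill_lastK : cancel (@mwiden n K) kill_last.
Proof.
move=> q; elim/mpolyind: q => [|c m q _ _ Hq]; first by rewrite rmorph0 rmorph0.
rewrite mwidenD mwidenZ rmorphD /= Hq -mul_mpolyC rmorphM /=; congr (_ + _).
rewrite {1}/kill_last mmapC -mul_mpolyC mwidenX; congr (_ * _).
rewrite /kill_last mmapX /mmap1 big_ord_recr /= mnmwiden_ordmax unlift_none mulr1.
rewrite mpolyXE_id; apply: eq_bigr => j _.
by rewrite mnmwiden_widen -lift_max liftK.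
Qed.

Lemma last_decomp (p : {mpoly K[n.+1]}) : exists q, p = mwiden (kill_last p) + X * q.
Proof.
suff [q' [q ->]] : exists q' q, p = mwiden q' + X * q.
  by exists q; rewrite rmorphD rmorphM /= kill_lastX mul0r addr0 kill_lastK.
elim/mpolyind: p => [|c m p _ _ [q' [q ->]]].
  by exists 0, 0; rewrite rmorph0 mulr0 addr0.
have [m' ->] := mpolyX_widen K m.
case: (m ord_max) => [|e].
  exists (c *: 'X_[m'] + q'), q.
  by rewrite expr0 mulr1 mwidenD mwidenZ addrA.
exists q', (c *: (mwiden 'X_[m'] * X ^+ e) + q).
by rewrite exprS mulrDr addrCA -scalerAr [X * (_ * _)]mulrCA.
Qed.

Lemma ct_kill_last p : (kill_last p)@_0%MM = p@_0%MM.
Proof.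
have [q Dp] := last_decomp p; rewrite [in RHS]Dp mcoeffD rmorphM /=.
by rewrite mcoeffX mnm1_eq0 mul0r addr0 -mnmwiden0 mwiden_mnmwiden.
Qed.

Lemma last_decomp_mx k m (M : 'M[{mpoly K[n.+1]}]_(k, m)) :
  exists Q, M = map_mx (@mwiden n K) (map_mx kill_last M) + X *: Q.
Proof.
have [f fP] := choice_fun last_decomp; exists (map_mx f M).
by apply/matrixP=> i j; rewrite !mxE.
Qed.

Lemma kill_last_mx_eq0 k m (M : 'M[{mpoly K[n.+1]}]_(k, m)) :
  map_mx kill_last M = 0 -> exists Q, M = X *: Q.
Proof.
move=> M0; have [Q DM] := last_decomp_mx M; exists Q.
by rewrite {1}DM M0 map_mx0 add0r.
Qed.

Lemma kill_lastK_mx k m (M : 'M[{mpoly K[n]}]_(k, m)) :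
  map_mx kill_last (map_mx (@mwiden n K) M) = M.
Proof. by rewrite -map_mx_comp map_mx_id // => x /=; rewrite kill_lastK. Qed.

Lemma mulX_inj k m : injective (fun M : 'M[{mpoly K[n.+1]}]_(k, m) => X *: M).
Proof.
have nzX : X != 0 by rewrite -msize_poly_eq0 msizeX.
move=> M M' /matrixP eqM; apply/matrixP=> i j.
by apply: (mulfI nzX); have := eqM i j; rewrite !mxE.
Qed.

End LastVariable.

(* Setting the last variable to 0 in the syzygies of a module (on which that
   variable is a non-zero-divisor, whatever the module) gives a minimal resolution
   over one variable less. *)
Section Peel.
Variables (K : fieldType) (n : nat) (r : nat -> nat).
Variable d : forall i, 'M[{mpoly K[n.+1]}]_(r i.+1, r i).
Hypotheses (ed : exact_cx d) (md : minimal_cx d).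

Local Notation X := ('X_ord_max : {mpoly K[n.+1]}).

Let d' i := map_mx (@kill_last K n) (d i.+1).

(** Lift a cycle [v] to [V], whose boundary is a multiple [X *: u]. Cancelling [X] makes [u] a
    cycle, hence the boundary of some [w], and [V - X *: w] is a cycle that reduces to [v]. *)
Lemma peel_exact : @exact_cx _ (r \o succn) d'.
Proof.
move=> i v /=; split=> [v0|[w ->]]; last first.
  by rewrite -mulmxA -map_mxM exact_cx_comp // map_mx0 mulmx0.
pose V := map_mx (@mwiden n K) v.
have [u Du] : exists u, V *m d i.+1 = X *: u.
  by apply: kill_last_mx_eq0; rewrite map_mxM kill_lastK_mx.
have u0 : u *m d i = 0.
  apply: (@mulX_inj K n); rewrite scaler0 scalemxAl -Du -mulmxA.
  by rewrite exact_cx_comp ?mulmx0.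
have [w Dw] := (ed _).1 u0.
have [|w' Dw'] := (ed (V - X *: w)).1.
  by rewrite mulmxBl -scalemxAl -Dw Du subrr.
exists (map_mx (@kill_last K n) w'); rewrite -map_mxM -Dw' map_mxB map_mxZ.
by rewrite /= kill_lastX scale0r subr0 kill_lastK_mx.
Qed.

Lemma peel_minimal : @minimal_cx _ _ (r \o succn) d'.
Proof.
move=> i; apply/matrixP=> a b; rewrite !mxE ct_kill_last.
by have /matrixP/(_ a b) := md i.+1; rewrite !mxE.
Qed.

(** This is the connecting map for multiplication by [X]: write [X *: v] as [w *m d 0%N] and reduce
    [w] modulo [X]. If the reduction is a boundary, cancelling [X] shows that [v] is one too. *)
Lemma peel_socle (v : 'rV_(r 0%N)) :
  (forall j, exists w, 'X_j *: v = w *m d 0%N) -> ~ (exists w, v = w *m d 0%N) ->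
  exists2 v' : 'rV_(r 1%N), (forall j, exists w, 'X_j *: v' = w *m d' 0%N)
    & ~ exists w, v' = w *m d' 0%N.
Proof.
move=> socv nv; have [w Dw] := socv ord_max.
exists (map_mx (@kill_last K n) w) => [j|[z Dz]].
  have [wj Dj] := socv (widen_ord (leqnSn n) j).
  have [|y Dy] := (ed ('X_(widen_ord (leqnSn n) j) *: w - X *: wj)).1.
    by rewrite mulmxBl -!scalemxAl -Dw -Dj !scalerA mulrC subrr.
  exists (map_mx (@kill_last K n) y); rewrite /d' -map_mxM -Dy map_mxB !map_mxZ.
  by rewrite /= kill_lastX scale0r subr0 kill_last_widX.
have [u Du] : exists u, w - map_mx (@mwiden n K) z *m d 1%N = X *: u.
  apply: kill_last_mx_eq0; rewrite map_mxB map_mxM kill_lastK_mx Dz.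
  exact: subrr.
case: nv; exists u; apply: (@mulX_inj K n).
rewrite Dw scalemxAl -Du mulmxBl -mulmxA exact_cx_comp //.
by rewrite mulmx0 subr0.
Qed.

End Peel.

(** Variables are peeled off one at a time, each lowering the degree by one. Without variables,
    minimality makes all differentials zero, so exactness leaves rank only in degree 0. The second
    part is the depth-zero case of Auslander-Buchsbaum: a socle element of the cokernel forces
    length exactly [n]. *)
Lemma syzygy (K : fieldType) (n : nat) (r : nat -> nat)
    (d : forall i, 'M[{mpoly K[n]}]_(r i.+1, r i)) :
  exact_cx d -> minimal_cx d ->
  (forall i, (n < i)%N -> r i = 0%N) /\
  (forall v : 'rV_(r 0%N), (forall j, exists w, 'X_j *: v = w *m d 0%N) ->
     ~ (exists w, v = w *m d 0%N) -> r n <> 0%N).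
Proof.
elim: n r d => [|n IHn] r d ed md.
  have d0 i : d i = 0.
    apply/matrixP=> a b; rewrite [LHS]nvar0_mpolyC mxE.
    by have /matrixP/(_ a b) := md i; rewrite !mxE => ->.
  split=> [[//|i] _|v _ nv r0].
    apply/eqP; rewrite -leqn0 leqNgt; apply/negP => lt0.
    have [w] := (ed i (const_mx 1)).1 (etrans (congr1 _ (d0 i)) (mulmx0 _ _)).
    rewrite d0 mulmx0 => /matrixP/(_ 0 (Ordinal lt0)); rewrite !mxE.
    by apply/eqP; rewrite oner_eq0.
  case: nv; exists 0; rewrite mul0mx; apply/rowP=> j.
  by exfalso; have := ltn_ord j; rewrite [X in (_ < X)%N]r0.
have [IH1 IH2] := IHn _ _ (peel_exact ed) (peel_minimal md).
split=> [[//|i] lti|v socv nv]; first exact: IH1.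
have [v' soc' nv'] := peel_socle ed socv nv.
exact: (IH2 v').
Qed.

(** * Regular sequences and mapping cones *)

Definition ideal_adj (R : comNzRingType) (J : R -> Prop) (f p : R) : Prop :=
  exists c, J (p - c * f).

Definition nzd (R : comNzRingType) (J : R -> Prop) (f : R) : Prop :=
  forall p, J (f * p) -> J p.

Section Adjunction.
Variable R : comNzRingType.
Implicit Types (J : R -> Prop) (f p : R) (s : seq R).

Lemma ideal_adj_ideal J f : is_ideal J -> is_ideal (ideal_adj J f).
Proof.
case=> J0 JD JM; split=> [|a b [c Jc] [e Je]|c a [e Je]].
- by exists 0; rewrite mul0r subr0.
- by exists (c + e); rewrite mulrDl opprD addrACA; apply: JD.
- by exists (c * e); rewrite -mulrA -mulrBr; apply: JM.
Qed.

Lemma ideal_adj_sub J f p : J p -> ideal_adj J f p.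
Proof. by move=> Jp; exists 0; rewrite mul0r subr0. Qed.

Lemma ideal_adj_mem J f : is_ideal J -> ideal_adj J f f.
Proof. by case=> J0 _ _; exists 1; rewrite mul1r subrr. Qed.

Lemma foldl_adj_min J s (Q : R -> Prop) : is_ideal Q -> (forall p, J p -> Q p) ->
  (forall f, f \in s -> Q f) -> forall p, foldl (@ideal_adj R) J s p -> Q p.
Proof.
move=> iQ; elim: s J => [|f s IHs] J JQ sQ p /=; first exact: JQ.
apply: IHs => [q [c Jq]|g sg]; last by apply: sQ; rewrite inE sg orbT.
case: iQ => _ QD QM; rewrite -(subrK (c * f) q); apply: QD; first exact: JQ.
by apply/QM/sQ/mem_head.
Qed.

Lemma foldl_adj_ideal J s : is_ideal J -> is_ideal (foldl (@ideal_adj R) J s).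
Proof. by elim: s J => //= f s IHs J iJ; apply/IHs/ideal_adj_ideal. Qed.

Lemma ideal_gen_cons f s p : ideal_gen (f :: s) p <-> exists c, ideal_gen s (p - c * f).
Proof.
split=> [[c ->]|[c [e De]]].
  exists (c ord0), (fun i => c (lift ord0 i)).
  by rewrite big_ord_recl /= addrC addKr.
exists (fun i => if unlift ord0 i is Some j then e j else c).
rewrite big_ord_recl unlift_none /= -(addrNK (c * f) p) De addrC.
by congr (_ + _); apply: eq_bigr => i _; rewrite liftK.
Qed.

Lemma ideal_addE J s : is_ideal J ->
  forall p, ideal_add J (ideal_gen s) p <-> foldl (@ideal_adj R) J s p.
Proof.
elim: s J => [|f s IHs] J iJ p /=.
  split=> [[a [b [Ja [c ->] ->]]]|Jp]; first by rewrite big_ord0 addr0.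
  by exists p, 0; split=> //; [exists (fun _ => 0); rewrite big_ord0 | rewrite addr0].
rewrite -IHs; last exact: ideal_adj_ideal.
split=> [[a [b [Ja /ideal_gen_cons[c gc] ->]]]|[a [b [[c Jc] gb ->]]]].
  exists (a + c * f), (b - c * f); split=> //; last by rewrite addrACA addrN addr0.
  by exists c; rewrite addrK.
exists (a - c * f), (c * f + b); split=> //; last by rewrite addrA subrK.
by apply/ideal_gen_cons; exists c; rewrite addrAC addrN add0r.
Qed.

(** Elements are adjoined one at a time, in step with iterated mapping cones. *)
Fixpoint rseq J s : Prop :=
  if s is f :: s' then nzd J f /\ rseq (ideal_adj J f) s' else ~ J 1.

Lemma regular_sequence_foldl J s : is_ideal J -> regular_sequence J s <->
  (forall i, (i < size s)%N -> nzd (foldl (@ideal_adj R) J (take i s)) s`_i)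
   /\ ~ foldl (@ideal_adj R) J s 1.
Proof.
move=> iJ; split=> -[h h1]; split; try by rewrite (ideal_addE s iJ) in h1 *.
  by move=> i lti p; rewrite -!ideal_addE //; apply: h.
by move=> i p lti; rewrite !ideal_addE //; apply: h.
Qed.

Lemma regular_sequence_rseq J s : is_ideal J -> regular_sequence J s <-> rseq J s.
Proof.
move=> iJ; rewrite regular_sequence_foldl //.
elim: s J iJ => [|f s IHs] J iJ /=; first by split=> [[]|].
rewrite -IHs; last exact: ideal_adj_ideal.
split=> [[h h1]|[hf [h h1]]]; last by split=> [[|i]|] //; apply: h.
by split; [apply: (h 0%N) | split=> // i; apply: (h i.+1)].
Qed.

End Adjunction.

Section Cone.
Variables (R : comNzRingType) (r : nat -> nat) (d : forall i, 'M[R]_(r i.+1, r i)).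
Variable f : R.

Definition cone_rank (i : nat) : nat := if i is j.+1 then (r i + r j)%N else r 0%N.

Definition cone_diff (i : nat) : 'M[R]_(cone_rank i.+1, cone_rank i) :=
  match i return 'M[R]_(cone_rank i.+1, cone_rank i) with
  | 0 => col_mx (d 0%N) f%:M
  | j.+1 => block_mx (d j.+1) 0 f%:M (- d j)
  end.

Lemma mul_cone_diff0 (u : 'rV_(r 1%N)) (w : 'rV_(r 0%N)) :
  row_mx u w *m cone_diff 0 = u *m d 0%N + f *: w.
Proof. by rewrite mul_row_col mul_mx_scalar. Qed.

Lemma mul_cone_diffS j (u : 'rV_(r j.+2)) (w : 'rV_(r j.+1)) :
  row_mx u w *m cone_diff j.+1 = row_mx (u *m d j.+1 + f *: w) (- (w *m d j)).
Proof. by rewrite mul_row_block mul_mx_scalar mulmx0 add0r mulmxN. Qed.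

Hypothesis ed : exact_cx d.
Hypothesis f_reg :
  forall w : 'rV_(r 0%N), (exists z, f *: w = z *m d 0%N) -> exists z, w = z *m d 0%N.

(** By [lift], it is enough that the second entry of a cycle be a boundary. In the lowest degree
    this is [f_reg], regularity of [f] on the cokernel of [d 0%N]; higher up, the entry is itself a
    cycle and [ed] applies. *)
Lemma cone_exact : exact_cx cone_diff.
Proof.
have lift j (u : 'rV_(r j.+1)) (w : 'rV_(r j)) :
    u *m d j + f *: w = 0 -> (exists z, w = z *m d j) ->
    exists z : 'rV_(cone_rank j.+2), row_mx u w = z *m cone_diff j.+1.
  move=> uw0 [z Dw].
  have [|y Dy] := (ed (u + f *: z)).1; first by rewrite mulmxDl -scalemxAl -Dw.
  exists (row_mx y (- z)); rewrite mul_cone_diffS -Dy scalerN addrK.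
  by rewrite mulNmx opprK Dw.
case=> [|j] v; split.
- rewrite -[v](@hsubmxK _ 1 (r 1) (r 0)) mul_cone_diff0 => uw0; apply: lift => //.
  apply: f_reg; exists (- lsubmx v).
  by apply/eqP; rewrite mulNmx -addr_eq0 addrC uw0.
- move=> [w ->]; rewrite -[w](@hsubmxK _ 1 (r 2) (r 1)) mul_cone_diffS mul_cone_diff0.
  by rewrite mulmxDl -mulmxA exact_cx_comp // mulmx0 add0r -scalemxAl scalerN addrN.
- rewrite -[v](@hsubmxK _ 1 (r j.+2) (r j.+1)) mul_cone_diffS.
  rewrite -[RHS](@row_mx0 _ 1 (r j.+1) (r j)) => /eq_row_mx[uw0 /eqP].
  by rewrite oppr_eq0 => /eqP/ed w0; apply: lift.
- move=> [w ->]; rewrite -[w](@hsubmxK _ 1 (r j.+3) (r j.+2)) !mul_cone_diffS.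
  rewrite mulmxDl -mulmxA exact_cx_comp // mulmx0 add0r -scalemxAl scalerN addrN.
  by rewrite mulNmx opprK -mulmxA exact_cx_comp // mulmx0 row_mx0.
Qed.

End Cone.

Lemma ct_scalar_mx (K : fieldType) (n k : nat) (f : {mpoly K[n]}) :
  f@_0%MM = 0 -> ct_mx (f%:M : 'M_k) = 0.
Proof.
by move=> f0; apply/matrixP=> a b; rewrite !mxE mcoeffMn f0 mul0rn.
Qed.

(** The cone has the same bottom term, so the augmentation is kept; the new scalar blocks are
    minimal because [f] has no constant term. *)
Lemma cone_resolution (K : fieldType) (n : nat) (J : {mpoly K[n]} -> Prop) r aug d f :
  is_ideal J -> @resolution K n J r aug d -> f@_0%MM = 0 -> nzd J f ->
  @resolution K n (ideal_adj J f) (cone_rank r) aug (cone_diff d f).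
Proof.
move=> iJ [surj ex0 ex min] f0 Jf; have [J0 JD JM] := iJ; split.
- by move=> p; have [v Jv] := surj p; exists v; apply: ideal_adj_sub.
- move=> v; split=> [[c Jc]|[w ->]].
    have [u Ju] := surj c.
    have [|w Dw] := (ex0 (v - f *: u)).1.
      have -> : ((v - f *: u) *m aug) 0 0 = (v *m aug) 0 0 - f * (u *m aug) 0 0.
        by rewrite mulmxBl -scalemxAl !mxE.
      by have := JD _ _ Jc (JM f _ Ju); rewrite mulrBr [c * f]mulrC addrA subrK.
    by exists (row_mx w u); rewrite mul_cone_diff0 -Dw subrK.
  rewrite -[w](@hsubmxK _ 1 (r 1%N) (r 0%N)) mul_cone_diff0.
  exists ((rsubmx w *m aug) 0 0).
  have -> : ((lsubmx w *m d 0%N + f *: rsubmx w) *m aug) 0 0 =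
      (lsubmx w *m d 0%N *m aug) 0 0 + f * (rsubmx w *m aug) 0 0.
    by rewrite mulmxDl -scalemxAl !mxE.
  by rewrite [f * _]mulrC addrK; apply/ex0; exists (lsubmx w).
- by apply: cone_exact => // w /ex0; rewrite -scalemxAl mxE => /Jf/ex0.
- case=> [|j]; rewrite /cone_diff.
    by rewrite map_col_mx min ct_scalar_mx // col_mx0.
  rewrite map_block_mx map_mx0 map_mxN !min ct_scalar_mx // oppr0.
  exact: block_mx0.
Qed.

(** A nonzero rank in degree [p] reappears in degree [p.+1] of the cone, and the syzygy theorem
    bounds where it ends up. *)
Lemma rseq_length (K : fieldType) (n : nat) (s : seq {mpoly K[n]}) J r aug d p :
  is_ideal J -> @resolution K n J r aug d -> r p <> 0%N ->
  (forall f, f \in s -> f@_0%MM = 0) -> rseq J s -> (p + size s <= n)%N.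
Proof.
elim: s J r aug d p => [|f s IHs] J r aug d p iJ F rp s0 /=.
  rewrite addn0 leqNgt => _; apply/negP=> ltnp; apply: rp.
  by case: F => _ _ ed md; case: (syzygy ed md) => h _; apply: h.
case=> Jf reg_s; rewrite addnS -addSn.
have f0 : f@_0%MM = 0 by apply: s0; rewrite mem_head.
apply: IHs (ideal_adj_ideal f iJ) (cone_resolution iJ F f0 Jf) _ _ reg_s => [|g sg].
  by rewrite /= => /eqP; rewrite addn_eq0 => /andP[_ /eqP].
by apply: s0; rewrite inE sg orbT.
Qed.

(** * Zero-divisors and prime avoidance *)

Section Noetherian.
Variable R : comNzRingType.
Hypothesis nR : noetherian R.

(** Indexing by [A] covers both annihilators of elements and ideals generated by lists. Without a
    maximum, choice builds a strictly increasing chain; its union is finitely generated, hence equal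
    to one of its terms. *)
Lemma noetherian_max (A : Type) (S : A -> Prop) (F : A -> R -> Prop) (a0 : A) :
  (forall a, S a -> is_ideal (F a)) -> S a0 ->
  exists a, [/\ S a, forall p, F a0 p -> F a p &
    forall b, S b -> (forall p, F a p -> F b p) -> forall p, F b p -> F a p].
Proof.
move=> iF Sa0; apply: NNPP => nomax.
pose B := {a | S a /\ forall p, F a0 p -> F a p}.
pose G (b : B) := F (proj1_sig b).
have next (b : B) : exists c : B,
    (forall p, G b p -> G c p) /\ exists p, G c p /\ ~ G b p.
  apply: NNPP => nb; case: b => a [Sa Fa] in nb *; apply: nomax; exists a; split=> //.
  move=> b Sb Fab p Fbp; apply: NNPP => nFap; apply: nb.
  by exists (exist _ b (conj Sb (fun q Fq => Fab q (Fa q Fq)))); split; last exists p.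
have [nx nxP] := choice_fun next.
pose b0 : B := exist _ a0 (conj Sa0 (fun p Fp => Fp)).
pose g i := iter i nx b0; pose U p := exists i, G (g i) p.
have iG b : is_ideal (G b) by case: b => a [Sa Fa]; apply: iF.
have mono i j p : (i <= j)%N -> G (g i) p -> G (g j) p.
  move/subnK<-; elim: (j - i)%N => // e IHe Gp.
  by apply: (nxP (g (e + i)%N)).1; apply: IHe.
have iU : is_ideal U.
  split=> [|p q [i Gp] [j Gq]|c p [i Gp]].
  - by exists 0%N; case: (iG (g 0%N)).
  - exists (maxn i j); have [_ GD _] := iG (g (maxn i j)).
    by apply: GD; [apply: mono Gp; apply: leq_maxl | apply: mono Gq; apply: leq_maxr].
  - by exists i; have [_ _] := iG (g i); apply.
have [k [c [Uc fgU]]] := noetherian_ideal_gen nR iU.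
have [ix ixP] := choice_fun Uc; pose M := (\max_i ix i)%N.
have [_ [p [Gp nGp]]] := nxP (g M); apply: nGp.
have [|w ->] := fgU p; first by exists M.+1.
rewrite mxE; apply: ideal_sum => // i; have [_ _] := iG (g M); apply.
by apply: mono (ixP i); apply: (leq_bigmax i).
Qed.

Variable J : R -> Prop.
Hypothesis iJ : is_ideal J.

Let ann s p := J (p * s).
Let annsub s t := forall p, ann s p -> ann t p.
(** These annihilators are the maximal associated primes of R/J. *)
Let maxann s := ~ J s /\ forall t, ~ J t -> annsub s t -> annsub t s.

Let ann_ideal s : is_ideal (ann s).
Proof.
case: iJ => J0 JD JM; split=> [|a b|c a]; rewrite /ann; first by rewrite mul0r.
  by rewrite mulrDl; apply: JD.
by rewrite -mulrA; apply: JM.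
Qed.

Let maxann_above s : ~ J s -> exists2 t, maxann t & annsub s t.
Proof.
move=> nJs.
have [t [nJt sst maxt]] := noetherian_max (S := fun t => ~ J t) (F := ann)
  (fun t _ => ann_ideal t) nJs.
by exists t.
Qed.

Let maxann_prime s p q : maxann s -> ann s (p * q) -> ~ ann s q -> ann s p.
Proof.
move=> [nJs maxs] Jpq nq; apply: (maxs (q * s) nq) => [x Jx|].
  by case: iJ => _ _ JM; rewrite /ann mulrCA; apply: JM.
by rewrite /ann mulrA.
Qed.

(** Multiply together one element of each [ann t] outside [ann s]; primality of [ann s] keeps the
    product outside. *)
Let separate s (l : seq R) : maxann s -> (forall t, t \in l -> ~ annsub t s) ->
  exists2 p, ~ ann s p & forall t, t \in l -> ann t p.
Proof.
move=> ms; elim: l => [|t l IHl] sep.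
  by exists 1 => //; rewrite /ann mul1r; case: ms.
have [|p np lp] := IHl; first by move=> u lu; apply: sep; rewrite inE lu orbT.
have [q [tq nq]] : exists q, ann t q /\ ~ ann s q.
  apply: NNPP => nq; apply: (sep t); first exact: mem_head.
  by move=> q tq; apply: NNPP => nsq; apply: nq; exists q.
exists (q * p) => [sqp|u]; first by apply: nq; apply: maxann_prime sqp np.
rewrite inE => /predU1P[->|lu]; last by case: (ann_ideal u) => _ _; apply; apply: lp.
by rewrite mulrC; case: (ann_ideal t) => _ _; apply.
Qed.

(* A maximal finitely generated ideal spanned by elements with maximal annihilator
   contains all such elements, so these annihilators are finitely many. *)
Let finite_maxann : exists2 l : seq R, (forall t, t \in l -> maxann t) &
  forall s, maxann s -> exists2 t, t \in l & annsub s t.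
Proof.
have [|l [ml _ maxl]] := noetherian_max (a0 := [::])
    (S := fun l : seq R => forall t, t \in l -> maxann t)
    (F := foldl (@ideal_adj R) J) (fun l _ => foldl_adj_ideal l iJ); first by [].
exists l => // s ms.
have Fs : foldl (@ideal_adj R) J l s.
  apply: (maxl (rcons l s)) => [t|p|]; rewrite ?foldl_rcons.
  - by rewrite mem_rcons inE => /predU1P[->|/ml].
  - exact: ideal_adj_sub.
  - exact/ideal_adj_mem/foldl_adj_ideal.
have sub p : (forall t, t \in l -> ann t p) -> ann s p.
  move=> pl; apply: (foldl_adj_min (Q := fun q => J (p * q))) Fs => [|q|//].
    have [i0 iD iM] := iJ; split=> [|a b|c a].
    - by rewrite mulr0.
    - by rewrite mulrDr; apply: iD.
    - by rewrite mulrCA; apply: iM.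
  by case: iJ => _ _; apply.
apply: NNPP => nt.
have [t lt nst|p np lp] := separate (l := l) ms; last by apply: np; apply: sub.
by apply: nt; exists t => //; apply: (ml t lt).2 nst; case: ms.
Qed.

(** Prime avoidance by induction on [l]. If the [f] found for the tail lies in [ann t], add [p * x]
    with [p] in all annihilators of the tail but not in [ann t], and [x] in [m] outside [ann t]. *)
Let avoid (m : R -> Prop) (l : seq R) : is_ideal m -> (forall t, t \in l -> maxann t) ->
  (forall t, t \in l -> exists2 f, m f & ~ ann t f) ->
  exists2 f, m f & forall t, t \in l -> ~ ann t f.
Proof.
case=> m0 mD mM; elim: l => [|t l IHl] ml nl; first by exists 0.
have mt : maxann t by apply/ml/mem_head.
have [u lu|u lu|f mf nf] := IHl.
- by apply: ml; rewrite inE lu orbT.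
- by apply: nl; rewrite inE lu orbT.
case: (excluded_middle_informative (ann t f)) => [tf|ntf]; last first.
  by exists f => // u; rewrite inE => /predU1P[->|/nf].
(* No annihilator of the tail lies in [ann t]: by maximality it would equal [ann t] and contain
   [f]. *)
have [u lu sut|p np lp] := separate (l := l) mt.
  apply: (nf u lu); apply: (ml u _).2 sut _ tf; first by rewrite inE lu orbT.
  by case: mt.
have [x mx nx] := nl t (mem_head _ _).
exists (f + p * x) => [|u]; first by apply: mD => //; apply: mM.
rewrite inE => /predU1P[->|lu] uf.
  apply: np; apply: maxann_prime (mt) _ nx.
  by rewrite -(addKr f (p * x)) addrC; apply: idealB.
apply: (nf u lu); rewrite -(addrK (p * x) f); apply: idealB => //.
by rewrite mulrC; case: (ann_ideal u) => _ _; apply; apply: lp.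
Qed.

(** Every zero-divisor modulo J lies in one of finitely many maximal annihilators. If [m] escapes
    each of them, avoidance gives [f]; if [m] lies in [ann t], then [t] is the socle element. *)
Lemma nzd_or_socle (m : R -> Prop) : is_ideal m ->
  (exists2 f, m f & nzd J f) \/ (exists2 s, ~ J s & forall f, m f -> J (f * s)).
Proof.
move=> im; have [l ml lP] := finite_maxann.
case: (excluded_middle_informative
  (forall t, t \in l -> exists2 f, m f & ~ ann t f)) => [h|nh].
  have [f mf nf] := avoid im ml h; left; exists f => // q Jfq; apply: NNPP => nJq.
  have [s ms sqs] := maxann_above nJq; have [t lt sst] := lP s ms.
  by apply: (nf t lt); apply/sst/sqs.
right; apply: NNPP => ns; apply: nh => t lt; apply: NNPP => nt; apply: ns.
exists t => [|f mf]; first by case: (ml t lt).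
by apply: NNPP => nf; apply: nt; exists f.
Qed.

End Noetherian.

Lemma irrelevant_is_ideal (K : fieldType) (n : nat) : is_ideal (@irrelevant_ideal K n).
Proof.
split=> [|a b|c a]; rewrite /irrelevant_ideal; first exact: mcoeff0.
  by rewrite mcoeffD => -> ->; rewrite addr0.
by rewrite rmorphM /= => ->; rewrite mulr0.
Qed.

Lemma rseq_exists (K : fieldType) (n : nat) (t : nat) (J : {mpoly K[n]} -> Prop)
    r aug d p :
  is_ideal J -> (forall q, J q -> irrelevant_ideal q) -> @resolution K n J r aug d ->
  (forall i, (p < i)%N -> r i = 0%N) -> (p + t <= n)%N ->
  exists s, [/\ size s = t, forall f, f \in s -> irrelevant_ideal f & rseq J s].
Proof.
elim: t J r aug d p => [|t IHt] J r aug d p iJ Jm F rp lept.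
  exists [::]; split=> //= /Jm; rewrite /irrelevant_ideal mcoeff1 eqxx.
  by apply/eqP; rewrite oner_eq0.
have [J0 JD JM] := iJ.
have [[f mf Jf]|[s nJs ms]] :=
  nzd_or_socle (@mpoly_noetherian K n) iJ (@irrelevant_is_ideal K n).
  have [|i||s [szs ms rs]] := IHt _ _ _ _ p.+1 (ideal_adj_ideal f iJ) _
    (cone_resolution iJ F mf Jf).
  - move=> q [c /Jm]; rewrite /irrelevant_ideal mcoeffB rmorphM /= mf mulr0.
    by rewrite subr0.
  - by case: i => // i ltpi; rewrite /= !rp // ltnW.
  - by rewrite addSnnS.
  exists (f :: s); split=> //=; first by rewrite szs.
  by move=> g; rewrite inE => /predU1P[->|/ms].
(* The socle element [s], written as [v *m aug] modulo J, would make [r n] nonzero, although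
   [p < n]. *)
have [surj ex0 ed md] := F; have [v Jv] := surj s.
have [_ soc] := syzygy ed md; case: (soc v).
- move=> j; apply/ex0; rewrite -scalemxAl mxE -(subKr ('X_j * s) (_ * _)).
  apply: idealB => //; first by apply: ms; rewrite /irrelevant_ideal mcoeffX mnm1_eq0.
  by rewrite -mulrBr; apply: JM.
- move=> /ex0 Jva; apply: nJs; rewrite -(subrK ((v *m aug) 0 0) s); exact: JD.
- by apply: rp; apply: leq_trans lept; rewrite addnS ltnS leq_addr.
Qed.

(** * Free extensions of polynomial rings given by disjoint monomials *)

Section LinearExtension.
Variables (K : fieldType) (n : nat) (V : lmodType K) (g : 'X_{1..n} -> V).

Definition lin_ext (p : {mpoly K[n]}) : V := \sum_(m <- msupp p) p@_m *: g m.

Lemma lin_extwE k p : (msize p <= k)%N ->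
  lin_ext p = \sum_(m : 'X_{1..n < k}) p@_m *: g m.
Proof.
move=> lt_pk; rewrite /lin_ext (big_mksub 'X_{1..n < k}) /=; first last.
- by move=> x /msize_mdeg_lt /leq_trans; apply.
- by rewrite msupp_uniq.
by rewrite big_rmcond //= => i; move/memN_msupp_eq0 ->; rewrite scale0r.
Qed.

Lemma lin_ext_is_linear : linear lin_ext.
Proof.
move=> c p q; pose k := maxn (msize (c *: p + q)) (maxn (msize p) (msize q)).
rewrite (@lin_extwE k) ?leq_maxl // (@lin_extwE k p) ?(@lin_extwE k q); first last.
- by rewrite !leq_max leqnn orbT.
- by rewrite !leq_max leqnn !orbT.
rewrite scaler_sumr -big_split /=; apply: eq_bigr => m _.
by rewrite mcoeffD mcoeffZ scalerDl scalerA.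
Qed.

HB.instance Definition _ :=
  GRing.isLinear.Build K {mpoly K[n]} V *:%R lin_ext lin_ext_is_linear.

Lemma lin_extX m : lin_ext 'X_[m] = g m.
Proof. by rewrite /lin_ext msuppX big_seq1 mcoeffX eqxx scale1r. Qed.

End LinearExtension.

Section Spread.
Variables (K : fieldType) (a b : nat) (tau : 'I_b -> 'I_a).
Hypothesis tau_surj : forall i, exists y, tau y = i.

Definition spreadm (m : 'X_{1..a}) : 'X_{1..b} := [multinom m (tau y) | y < b].

(* [spread] maps the variable X_i to the product of the variables X_y, tau y = i. *)
Definition spread : {mpoly K[a]} -> {mpoly K[b]} :=
  mmap (@mpolyC b K) (fun i => 'X_[spreadm U_(i)]).

HB.instance Definition _ := GRing.RMorphism.on spread.

(* The largest [e] such that [spreadm e] divides [m]. *)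
Definition lowm (m : 'X_{1..b}) : 'X_{1..a} :=
  [multinom \big[minn/mdeg m]_(y | tau y == i) m y | i < a].

Lemma lowm_le (m : 'X_{1..b}) y : (lowm m (tau y) <= m y)%N.
Proof.
rewrite mnmE; elim: (index_enum _) (mem_index_enum y) => // z s IHs.
rewrite inE big_cons => /predU1P[<-|/IHs le]; first by rewrite eqxx geq_minl.
by case: ifP => // _; rewrite geq_min le orbT.
Qed.

Lemma lowm_attained (m : 'X_{1..b}) i : exists2 y, tau y = i & lowm m i = m y.
Proof.
have [y0 Dy0] := tau_surj i.
have le_deg y : (m y <= mdeg m)%N by rewrite mdegE (bigD1 y) //= leq_addr.
suff : exists2 y, tau y = i & (m y <= lowm m i)%N.
  by case=> y <- le; exists y => //; apply/eqP; rewrite eqn_leq le lowm_le.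
rewrite mnmE; elim/big_ind: _ => [|u v [y Dy lty] [z Dz ltz]|y /eqP Dy].
- by exists y0.
- by case: (leqP u v) => _; [exists y | exists z].
- by exists y.
Qed.

Lemma lowm_spread m e : lowm (m + spreadm e) = (lowm m + e)%MM.
Proof.
apply/mnmP=> i; rewrite mnmDE; apply/eqP; rewrite eqn_leq; apply/andP; split.
  have [y Dy ->] := lowm_attained m i.
  by rewrite -Dy (leq_trans (lowm_le _ y)) // mnmDE mnmE.
have [y Dy ->] := lowm_attained (m + spreadm e) i.
by rewrite mnmDE [spreadm e y]mnmE -Dy leq_add2r lowm_le.
Qed.

Lemma spreadmD e f : spreadm (e + f) = (spreadm e + spreadm f)%MM.
Proof. by apply/mnmP=> y; rewrite !(mnmE, mnmDE). Qed.

(** The basis part of [m]: by [resmK], [m] is this monomial times the spread of [lowm m]. *)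
Definition resm (m : 'X_{1..b}) : 'X_{1..b} := (m - spreadm (lowm m))%MM.

Lemma resmK m : (resm m + spreadm (lowm m))%MM = m.
Proof. by apply/submK/mnm_lepP=> y; rewrite mnmE lowm_le. Qed.

Lemma resm_spread m e : resm (m + spreadm e) = resm m.
Proof. by rewrite /resm lowm_spread spreadmD [(spreadm (lowm m) + _)%MM]addmC -submDA addmK. Qed.

Lemma lowm0 : lowm 0 = 0%MM.
Proof.
by apply/mnmP=> i; have [y _ ->] := lowm_attained 0 i; rewrite !mnm0E.
Qed.

Lemma lowmK e : lowm (spreadm e) = e.
Proof. by rewrite -[spreadm e]add0m lowm_spread lowm0 add0m. Qed.

Lemma spreadX e : spread 'X_[e] = 'X_[spreadm e].
Proof.
rewrite /spread mmapX /mmap1.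
rewrite mprodXnE; congr 'X_[_]; apply/mnmP=> y.
rewrite mnm_sumE mnmE (bigD1 (tau y)) //= mulmnE mnmE mnm1E eqxx mul1n.
rewrite big1 ?addn0 // => i nei.
by rewrite mulmnE mnmE mnm1E (negbTE nei).
Qed.

Lemma spreadZ c p : spread (c *: p) = c *: spread p.
Proof. by rewrite -!mul_mpolyC rmorphM /= {1}/spread mmapC. Qed.

Lemma ct_spread p : (spread p)@_0%MM = p@_0%MM.
Proof.
elim/mpolyind: p => [|c m p _ _ IHp]; first by rewrite rmorph0 !mcoeff0.
rewrite rmorphD /= spreadZ spreadX !mcoeffD IHp !mcoeffZ !mcoeffX.
congr (_ * (nat_of_bool _)%:R + _).
apply/eqP/eqP=> [m0|->]; last by apply/mnmP=> y; rewrite mnmE !mnm0E.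
by rewrite -[m]lowmK m0 lowm0.
Qed.

(** The coordinate along the basis monomial ['X_[c]]. It vanishes when [c] is not of the form
    [resm m], so sums may run over all bounded [c]. *)
Definition component (c : 'X_{1..b}) : {mpoly K[b]} -> {mpoly K[a]} :=
  lin_ext (fun m => if resm m == c then 'X_[lowm m] else 0).

HB.instance Definition _ c := GRing.Linear.on (component c).

Lemma componentX c m : component c 'X_[m] = if resm m == c then 'X_[lowm m] else 0.
Proof. exact: lin_extX. Qed.

Lemma component_spread c t s : component c (t * spread s) = component c t * s.
Proof.
elim/mpolyind: s => [|x e s _ _ IHs]; first by rewrite rmorph0 !mulr0 linear0.
rewrite rmorphD /= spreadZ spreadX !mulrDr linearD /= IHs; congr (_ + _).
rewrite -!scalerAr linearZ /=; congr (_ *: _).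
elim/mpolyind: t {IHs} => [|y m t _ _ IHt]; first by rewrite mul0r linear0 mul0r.
rewrite mulrDl !linearD /= IHt mulrDl -!scalerAl !linearZ /=; congr (_ + _).
rewrite -mpolyXD !componentX resm_spread lowm_spread -scalerAl.
by case: eqP => _; rewrite ?mul0r // mpolyXD.
Qed.

Lemma component_decomp D t : (msize t <= D)%N ->
  t = \sum_(c : 'X_{1..b < D}) 'X_[c] * spread (component c t).
Proof.
move=> szt; rewrite {1}[t](mpolywE szt).
have Dc c : component c t = \sum_(m : 'X_{1..b < D}) t@_m *:
    (if resm m == c then 'X_[lowm m] else 0) by apply: lin_extwE.
under [in RHS]eq_bigr do rewrite Dc rmorph_sum mulr_sumr.
rewrite exchange_big /=; apply: eq_bigr => m _.
have ltD : (mdeg (resm m) < D)%N by rewrite (leq_ltn_trans (mdegB _ _)) ?bmdeg.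
rewrite (bigD1 (BMultinom ltD)) //= eqxx big1 ?addr0 => [|c nec].
  by rewrite spreadZ spreadX -scalerAr -mpolyXD resmK.
rewrite ifN; first by rewrite spreadZ rmorph0 scaler0 mulr0.
by rewrite bmeqP eq_sym in nec.
Qed.

Lemma component_spread_mx c k l m (M : 'M_(k, l)) (N : 'M_(l, m)) :
  map_mx (component c) (M *m map_mx spread N) = map_mx (component c) M *m N.
Proof.
apply/matrixP=> i j; rewrite !mxE linear_sum; apply: eq_bigr => h _.
by rewrite !mxE; apply: component_spread.
Qed.

Lemma component_decomp_mx k l (M : 'M[{mpoly K[b]}]_(k, l)) : exists D : nat,
  M = \sum_(c : 'X_{1..b < D}) 'X_[c] *: map_mx spread (map_mx (component c) M).
Proof.
exists (\max_i \max_j msize (M i j))%N; apply/matrixP=> i j.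
rewrite summxE.
have le : (msize (M i j) <= \max_i \max_j msize (M i j))%N.
  apply: leq_trans (leq_bigmax i); exact: (leq_bigmax (F := fun j => msize (M i j)) j).
rewrite {1}(component_decomp le); apply: eq_bigr => c _; by rewrite !mxE.
Qed.

(** Freeness in use: a linear system with coefficients from the small ring is solved coordinate by
    coordinate. *)
Lemma component_solve k l m (M : 'M_(k, l)) (N : 'M_(m, l)) :
  (forall c, exists W, map_mx (component c) M = W *m N) ->
  exists W, M = W *m map_mx spread N.
Proof.
case/choice_fun=> W DW; have [D ->] := component_decomp_mx M.
exists (\sum_(c : 'X_{1..b < D}) 'X_[c] *: map_mx spread (W c)).
rewrite mulmx_suml; apply: eq_bigr => c _.
by rewrite -scalemxAl -map_mxM -DW.
Qed.

Section Transport.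
Variables (J : {mpoly K[a]} -> Prop) (J' : {mpoly K[b]} -> Prop) (P : pred 'X_{1..a}).
Hypotheses (iJ : is_ideal J) (iJ' : is_ideal J').
Hypothesis JP : forall p, J p <-> forall m, m \in msupp p -> P m.
Hypothesis J'P : forall p, J' p <-> forall m, m \in msupp p -> P (lowm m).

Let spread_ideal p : J p -> J' (spread p).
Proof.
move=> /JP Pp; case: (iJ') => J0 JD JM; rewrite [p]mpolyE rmorph_sum /= big_seq.
apply: big_ind => // m /Pp Pm; rewrite spreadZ spreadX -mul_mpolyC; apply: JM.
by apply/J'P => e; rewrite msuppX inE => /eqP->; rewrite lowmK.
Qed.

(** That J' is the extension of J, read on coordinates: both ideals are monomial, and [P] tests only
    the part [lowm m]. *)
Let componentP p : J' p <-> forall c, J (component c p).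
Proof.
split=> [/J'P Pp c|Jc].
  rewrite /component /lin_ext big_seq; case: (iJ) => J0 JD JM.
  apply: big_ind => // m /Pp Pm; rewrite -mul_mpolyC; apply: JM.
  by case: ifP => _ //; apply/JP => e; rewrite msuppX inE => /eqP->.
rewrite (component_decomp (leqnn (msize p))); apply: ideal_sum => // c.
by case: (iJ') => _ _; apply; apply: spread_ideal.
Qed.

Let component_mul_col c k (v : 'rV_k) (u : 'cV_k) :
  component c ((v *m map_mx spread u) 0 0) = (map_mx (component c) v *m u) 0 0.
Proof. by rewrite -component_spread_mx [RHS]mxE. Qed.

(** Surjectivity and exactness are checked on coordinates; minimality holds because [spread]
    preserves constant terms. *)
Lemma spread_resolution r aug d : resolution J aug d ->
  @resolution K b J' r (map_mx spread aug) (fun i => map_mx spread (d i)).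
Proof.
case=> surj ex0 ex md; split.
- move=> p; have [f fP] := choice_fun (fun c => surj (component c p)).
  pose D := msize p.
  exists (\sum_(c : 'X_{1..b < D}) 'X_[c] *: map_mx spread (f c)).
  rewrite {1}(component_decomp (leqnn (msize p))) mulmx_suml summxE -sumrB.
  apply: ideal_sum => // c; rewrite -scalemxAl -map_mxM.
  have -> : ('X_[c] *: map_mx spread (f c *m aug)) 0 0 =
      'X_[c] * spread ((f c *m aug) 0 0) by rewrite mxE [X in _ * X]mxE.
  rewrite -mulrBr -rmorphB; case: (iJ') => _ _; apply; exact: spread_ideal.
- move=> v; rewrite componentP; split=> [Jv|[w ->] c].
    by apply: component_solve => c; apply/ex0; rewrite -component_mul_col.
  rewrite component_mul_col component_spread_mx; apply/ex0.
  by exists (map_mx (component c) w).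
- move=> i v; split=> [v0|[w ->]].
    apply: component_solve => c; apply/ex; rewrite -component_spread_mx v0.
    by apply/matrixP=> x y; rewrite !mxE linear0.
  have d0 : d i.+1 *m d i = 0 by apply: exact_cx_comp.
  by rewrite -mulmxA -map_mxM d0 map_mx0 mulmx0.
- move=> i; apply/matrixP=> x y; rewrite !mxE ct_spread.
  by have /matrixP/(_ x y) := md i; rewrite !mxE.
Qed.

End Transport.
End Spread.

(** * Squarefree monomial ideals and their dimension *)

Lemma monomial_ideal (K : fieldType) (n : nat) (P : pred 'X_{1..n}) :
  (forall m e, P m -> P (m + e)%MM) ->
  is_ideal (fun p : {mpoly K[n]} => forall m, m \in msupp p -> P m).
Proof.
move=> upP; split=> [m|p q hp hq m /msuppD_le|c p hp m /msuppM_le].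
- by rewrite msupp0.
- by rewrite mem_cat => /orP[/hp|/hq].
- by case/allpairsP=> -[e f] /= [_ /hp Pf ->]; rewrite addmC; apply: upP.
Qed.

Lemma ideal_gen_ideal (R : comNzRingType) (s : seq R) : is_ideal (ideal_gen s).
Proof.
split=> [|_ _ [c ->] [e ->]|x _ [c ->]].
- by exists (fun _ => 0); rewrite big1 // => i _; rewrite mul0r.
- exists (fun i => c i + e i); rewrite -big_split.
  by apply: eq_bigr => i _; rewrite mulrDl.
- by exists (fun i => x * c i); rewrite mulr_sumr; apply: eq_bigr => i _; rewrite mulrA.
Qed.

Lemma ideal_gen_mem (R : comNzRingType) (s : seq R) f : f \in s -> ideal_gen s f.
Proof.
rewrite -index_mem => lt; exists (fun i => (i == Ordinal lt)%:R).
rewrite (bigD1 (Ordinal lt)) //= eqxx mul1r nth_index -?index_mem // big1 ?addr0 //.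
by move=> i /negbTE->; rewrite mul0r.
Qed.

Lemma ideal_gen_min (R : comNzRingType) (s : seq R) (Q : R -> Prop) :
  is_ideal Q -> (forall f, f \in s -> Q f) -> forall p, ideal_gen s p -> Q p.
Proof.
move=> iQ sQ _ [c ->]; apply: ideal_sum => // i.
by case: iQ => _ _; apply; apply/sQ/mem_nth.
Qed.

Section FacetIdeal.
Variables (K : fieldType) (V : finType).
Local Notation S := {mpoly K[#|V|]}.
Implicit Types (F : {set V}) (D : {set {set V}}).

Definition hits F (m : 'X_{1..#|V|}) : bool :=
  [exists v in F, m (enum_rank v) != 0%N].

Lemma hits_up F m e : hits F m -> hits F (m + e)%MM.
Proof.
case/exists_inP=> v Fv nz; apply/exists_inP; exists v => //.
by rewrite mnmDE addn_eq0 negb_and nz.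
Qed.

Lemma var_idealP F (p : S) : var_ideal F p <-> forall m, m \in msupp p -> hits F m.
Proof.
split.
  move: p; apply: (ideal_gen_min (Q := fun p => forall m, m \in msupp p -> hits F m)).
    by apply: monomial_ideal => m e; apply: hits_up.
  move=> _ /mapP[v Fv ->] m.
  rewrite mem_enum in Fv; rewrite msuppX inE => /eqP->.
  by apply/exists_inP; exists v; rewrite ?mnm1E ?eqxx.
move=> hp; have [I0 ID IM] := ideal_gen_ideal [seq var K v | v <- enum F].
rewrite [p]mpolyE big_seq; apply: big_ind => // m /hp/exists_inP[v Fv nz].
rewrite -mul_mpolyC; apply: (IM).
have le1 : (U_(enum_rank v) <= m)%MM by rewrite lep1mP.
rewrite -(submK le1) mpolyXD; apply: (IM); apply: ideal_gen_mem.
by apply: map_f; rewrite mem_enum.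
Qed.

Definition facet_hits D (m : 'X_{1..#|V|}) : bool := [forall F in facets D, hits F m].

Lemma facet_ideal_dualP D (p : S) :
  facet_ideal_dual D p <-> forall m, m \in msupp p -> facet_hits D m.
Proof.
split=> [hp m mp|hp F DF].
  by apply/forall_inP=> F DF; exact: ((var_idealP F p).1 (hp F DF) m mp).
by apply/var_idealP => m /hp/forall_inP; apply.
Qed.

Lemma facet_ideal_dual_ideal D : is_ideal (@facet_ideal_dual K V D).
Proof.
have [I0 ID IM] : is_ideal (fun p : S => forall m, m \in msupp p -> facet_hits D m).
  apply: monomial_ideal => m e /forall_inP h.
  by apply/forall_inP=> F /h; apply: hits_up.
split=> [|p q|c p]; rewrite !facet_ideal_dualP //; [exact: ID | exact: IM].
Qed.

Lemma facet_ideal_dual_irrelevant D F (p : S) :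
  F \in facets D -> facet_ideal_dual D p -> irrelevant_ideal p.
Proof.
move=> DF /facet_ideal_dualP hp; apply/eqP; rewrite mcoeff_eq0; apply/negP.
by move/hp/forall_inP/(_ F DF)/exists_inP=> [v _]; rewrite mnm0E.
Qed.

Lemma facet_ideal_dual_pihomog D e (p : S) :
  facet_ideal_dual D p -> facet_ideal_dual D (pihomog mdeg e p).
Proof.
have [I0 ID IM] := facet_ideal_dual_ideal D.
move/facet_ideal_dualP=> hp; rewrite pihomogE big_seq_cond.
apply: big_ind => // m /andP[mp _]; rewrite -mul_mpolyC; apply: (IM).
by apply/facet_ideal_dualP => f; rewrite msuppX inE => /eqP->; apply: hp.
Qed.

Definition kill (F : {set V}) : S -> S :=
  mmap (@mpolyC _ K) (fun i => if enum_val i \in F then 0 else 'X_i).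

HB.instance Definition _ F := GRing.RMorphism.on (kill F).

Lemma kill_var F v : kill F (var K v) = if v \in F then 0 else var K v.
Proof. by rewrite /kill mmapX mmap1U enum_rankK. Qed.

Lemma kill_kill (F G : {set V}) (p : S) : F \subset G -> kill G (kill F p) = kill G p.
Proof.
move=> /subsetP sFG; elim/mpolyind: p => [|c m p _ _ IHp]; first by rewrite !rmorph0.
have killC H : kill H c%:MP = c%:MP by rewrite /kill mmapC.
rewrite -mul_mpolyC !rmorphD !rmorphM /= !killC IHp; congr (_ * _ + _).
rewrite mpolyXE_id !rmorph_prod; apply: eq_bigr => i _.
rewrite !rmorphXn /=; congr (_ ^+ _).
have := kill_var G (enum_val i); have := kill_var F (enum_val i).
rewrite /var enum_valK => -> ->; case: ifP => [/sFG ->|_]; first by rewrite rmorph0.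
by have := kill_var G (enum_val i); rewrite /var enum_valK.
Qed.

Lemma kill_var_ideal F (p : S) : var_ideal F p -> kill F p = 0.
Proof.
apply: (ideal_gen_min (Q := fun q => kill F q = 0)) => [|_ /mapP[v Fv ->]].
  split=> [|a b|c a]; rewrite ?rmorph0 ?rmorphD ?rmorphM //= => ->.
    by move->; rewrite addr0.
  by rewrite mulr0.
by rewrite kill_var; rewrite mem_enum in Fv; rewrite Fv.
Qed.

(** The prime P_F written as a kernel: this gives the boolean predicate that [prime_chain] asks for,
    and primality comes from the target being a domain. *)
Definition kernel_pred F : {pred S} := [pred p | kill F p == 0].

Lemma kernel_prime F :
  idealr_closed (kernel_pred F) /\ prime_idealr_closed (kernel_pred F).
Proof.
split; last by move=> p q; rewrite !inE rmorphM /= mulf_eq0.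
split=> [||a u v]; rewrite !inE ?rmorph0 ?rmorph1 ?oner_eq0 //.
by rewrite rmorphD rmorphM /= => /eqP-> /eqP->; rewrite mulr0 addr0.
Qed.

(** Start at P_F and adjoin the variables outside [F] one by one; the new variable witnesses each
    strict inclusion. *)
Lemma facet_chain D F : F \in facets D ->
  exists P, prime_chain (@facet_ideal_dual K V D) (#|V| - #|F|) P.
Proof.
move=> DF; pose G i := F :|: [set v in take i (enum (~: F))].
have sub i : G i \subset G i.+1.
  apply/setUS/subsetP=> v; rewrite !inE => vi.
  have [le|lt] := leqP (size (enum (~: F))) i.
    by rewrite take_oversize ?(leqW le) //; apply: mem_take vi.
  have [v0 _] : {v : V | true} by case: (enum _) lt => // v1 *; exists v1.
  by rewrite (take_nth v0) // mem_rcons inE vi orbT.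
exists (fun i => kernel_pred (G i)); split=> [i _|p Jp|i lti].
- exact: kernel_prime.
- rewrite inE; apply/eqP.
  rewrite (_ : G 0%N = F); first exact/kill_var_ideal/Jp.
  by apply/setP=> v; rewrite !inE take0 orbF.
split=> [p|]; first by rewrite !inE => /eqP p0; rewrite -(kill_kill _ (sub i)) p0 rmorph0.
have szF : size (enum (~: F)) = (#|V| - #|F|)%N.
  by rewrite -cardE -(cardsC F) addKn.
have [v0 _] : {v : V | true}.
  by rewrite -szF in lti; case: (enum _) lti => // v1 *; exists v1.
rewrite -szF in lti; pose v := nth v0 (enum (~: F)) i.
exists (var K v); rewrite inE kill_var.
  by rewrite !inE (take_nth v0) // mem_rcons mem_head orbT eqxx.
have vF : v \in enum (~: F) by apply: mem_nth.
rewrite ifN -?msize_poly_eq0 ?msizeX //.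
rewrite !inE negb_or; rewrite mem_enum inE in vF; rewrite vF /=.
by rewrite in_take_leq ?index_uniq ?enum_uniq ?ltnn // ltnW.
Qed.

End FacetIdeal.

(** * The dimension bound *)

(** Exponent vectors of length [s] with entries below [B], nested so that the first witness of a
    chain splits off. *)
Fixpoint digits (B s : nat) : finType :=
  if s is s'.+1 then ('I_B * digits B s')%type : finType else unit.

Fixpoint digit_monomial (R : comNzRingType) (B s : nat) (y : nat -> R) :
    digits B s -> R :=
  match s with
  | 0 => fun _ => 1
  | s'.+1 => fun x => y 0%N ^+ x.1 * digit_monomial (y \o succn) x.2
  end.

Lemma card_digits B s : #|digits B s| = (B ^ s)%N.
Proof. by elim: s => [|s IHs] /=; rewrite ?card_unit // card_prod card_ord IHs expnS. Qed.

Section Chain.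
Variables (K : fieldType) (n : nat).
Local Notation S := {mpoly K[n]}.

(* A chain of ideals of length [s] whose steps are witnessed by [y]; prime chains
   and regular sequences both give such chains. *)
Definition nzd_chain (s : nat) (I : nat -> S -> Prop) (y : nat -> S) : Prop :=
  [/\ forall i, (i <= s)%N -> is_ideal (I i), ~ I s 1 &
    forall i, (i < s)%N -> [/\ nzd (I i) (y i), I i.+1 (y i) &
      forall p, I i p -> I i.+1 p]].

(** Group the sum by powers of [y 0%N] and take the lowest power [e] whose coefficient [q f] is not
    yet known to vanish. Cancelling [y 0%N ^+ e], regular modulo [I 0%N], puts [q f] in [I 1%N],
    which contains [y 0%N]; the shorter chain then applies. *)
Lemma digit_monomial_indep B s I y (c : digits B s -> K) : nzd_chain s I y ->
  I 0%N (\sum_x c x *: digit_monomial y x) -> forall x, c x = 0.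
Proof.
elim: s I y c => [|s IHs] I y c [iI I1 ch] I0.
  move=> x; apply/eqP/negPn/negP=> nz; apply: I1; have [_ _ IM] := iI 0%N (leqnn _).
  have -> : 1 = ((c x)^-1)%:MP * (\sum_x c x *: 1) :> S.
    rewrite (big_pred1 x) => [|z]; last by apply/esym/eqP; move: (x) (z) => [] [].
    by rewrite mul_mpolyC scalerA mulVf // scale1r.
  exact: IM.
have [reg0 I1y I01] := ch 0%N (ltn0Sn _).
pose q (e : 'I_B) := \sum_z c (e, z) *: digit_monomial (y \o succn) z.
have Dsum : \sum_x c x *: digit_monomial y x = \sum_(e < B) y 0%N ^+ e * q e.
  rewrite [RHS](eq_bigr (fun e : 'I_B => \sum_z c (e, z) *: digit_monomial y ((e, z) : digits B s.+1))).
    by rewrite pair_bigA /=; apply: eq_bigr => -[].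
  by move=> e _; rewrite mulr_sumr; apply: eq_bigr => z _; rewrite -scalerAr.
have chS : nzd_chain s (I \o succn) (y \o succn).
  by split=> // i lei; [apply: iI | apply: ch].
have [I1_0 I1D I1M] := iI 1%N (ltn0Sn _).
suff c0 (e : 'I_B) z : c (e, z) = 0 by case.
elim/ltn_ind: {e}(e : nat) {-2}e (erefl (e : nat)) z => e IHe f Df.
have q0 (g : 'I_B) : (g < e)%N -> q g = 0.
  by move=> lt; rewrite /q big1 // => z _; rewrite (IHe g) ?scale0r.
apply: (IHs _ _ (fun z => c (f, z)) chS); rewrite /= -/(q f).
pose u := \sum_(g : 'I_B | (e < g)%N) y 0%N ^+ (g - e.+1) * q g.
have DI : \sum_x c x *: digit_monomial y x = y 0%N ^+ e * (q f + y 0%N * u).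
  rewrite Dsum (bigD1 f) //= -Df mulrDr mulrA -exprSr /u [X in _ = _ + X]mulr_sumr.
  congr (_ + _).
  rewrite big_mkcond [RHS]big_mkcond; apply: eq_bigr => g _.
  rewrite -val_eqE /= -Df; case: (ltngtP g f) => //= lt.
    by rewrite q0 ?mulr0 -?Df.
  by rewrite mulrA -exprD subnKC.
have : I 0%N (q f + y 0%N * u).
  rewrite DI in I0; elim: {DI IHe q0 Df u}e (q f + _) I0 => [|e IHe] p.
    by rewrite mul1r.
  by rewrite exprS -mulrA => /reg0/IHe.
move/I01 => I1q; rewrite -[q f](addrK (y 0%N * u)); apply: idealB => //.
by rewrite mulrC; apply: I1M.
Qed.

Lemma msizeM_le_pred (p q : S) : (msize (p * q) <= (msize p + msize q).-1)%N.
Proof.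
have [->|nz_p] := eqVneq p 0; first by rewrite mul0r msize0.
have [->|nz_q] := eqVneq q 0; first by rewrite mulr0 msize0.
by rewrite msizeM.
Qed.

Lemma msize_exp_le C (p : S) e : (msize p <= C.+1)%N -> (msize (p ^+ e) <= (e * C).+1)%N.
Proof.
move=> hp; elim: e => [|e IHe]; first by rewrite expr0 msize1.
by rewrite exprS (leq_trans (msizeM_le_pred _ _)) // mulSn; lia.
Qed.

Lemma msize_digit_monomial C B s y (x : digits B s) :
  (forall i, (i < s)%N -> (msize (y i : S) <= C.+1)%N) ->
  (msize (digit_monomial y x) <= (s * (B * C)).+1)%N.
Proof.
elim: s y x => [|s IHs] y x hy; first by rewrite msize1.
case: x => e z; rewrite /= (leq_trans (msizeM_le_pred _ _)) //.
have h1 := msize_exp_le e (hy 0%N (ltn0Sn _)).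
have h2 := IHs (y \o succn) z (fun i lt => hy i.+1 lt).
have h3 : (e * C <= B * C)%N by rewrite leq_mul2r (ltnW (ltn_ord _)) orbT.
rewrite mulSn; have := leq_add (leq_trans h1 (h3 : (_ < _.+1)%N)) h2.
by rewrite addSn addnS; case: (_ + _)%N.
Qed.

Lemma left_kernel p q (M : 'M[K]_(p, q)) : (q < p)%N ->
  exists2 u : 'rV_p, u != 0 & u *m M = 0.
Proof.
move=> ltqp; exists (nz_row (kermx M)); last by apply/sub_kermxP/nz_row_sub.
rewrite nz_row_eq0 -mxrank_eq0 mxrank_ker subn_eq0 -ltnNge.
exact: leq_ltn_trans (rank_leq_col M) ltqp.
Qed.

End Chain.

Section DimensionBound.
Variables (K : fieldType) (V : finType) (D : {set {set V}}) (d : nat).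
Hypothesis facet_codim : forall F, F \in facets D -> (#|~: F| <= d)%N.
Local Notation S := {mpoly K[#|V|]}.

(* [off_monomial (F, g)] is supported outside [F], with exponents listed by [g]. *)
Let off_monomial b (x : {set V} * {ffun 'I_d -> 'I_b.+1}) : 'X_{1..#|V|} :=
  [multinom if enum_val i \in x.1 then 0%N else
     if insub (index (enum_val i) (enum (~: x.1))) is Some j then x.2 j : nat else 0%N
   | i < #|V|].

Let off_monomialP b F (m : 'X_{1..#|V|}) : F \in facets D -> ~~ hits F m ->
  (mdeg m <= b)%N -> exists g, m = off_monomial (F, g : {ffun 'I_d -> 'I_b.+1}).
Proof.
move=> DF nF degm.
exists [ffun j : 'I_d => if [pick v in ~: F | index v (enum (~: F)) == j] is Some v
  then inord (m (enum_rank v)) else ord0].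
apply/mnmP=> i; rewrite mnmE /=.
case: ifP => [Fi|/negbT nFi].
  apply/eqP/negPn; apply: contra nF => nz.
  by apply/exists_inP; exists (enum_val i); rewrite ?enum_valK.
have mi : enum_val i \in ~: F by rewrite inE.
have lt : (index (enum_val i) (enum (~: F)) < d)%N.
  by rewrite (leq_trans _ (facet_codim DF)) // cardE index_mem mem_enum.
rewrite insubT ffunE; case: pickP => [v /andP[vF /eqP Dv]|/(_ (enum_val i))].
  have -> : v = enum_val i.
    by apply: (@index_inj _ v (enum (~: F))); rewrite ?mem_enum.
  rewrite enum_valK inordK // ltnS (leq_trans _ degm) //.
  by rewrite mdegE (bigD1 i) //= leq_addr.
by rewrite mi eqxx.
Qed.

(** There are more digit monomials than monomials outside J in the degrees they reach, so a
    nontrivial combination of them lies in J, against independence. *)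
Lemma nzd_chain_bound I y :
  (forall p, @facet_ideal_dual K V D p -> I 0%N p) -> nzd_chain d.+1 I y -> False.
Proof.
move=> JI ch.
(* [C] bounds the witnesses and [b] the degree of the digit monomials. At most [2 ^ #|V| * b.+1 ^ d]
   monomials up to that degree miss some facet, and [b.+1 <= A * B]; taking [B] just above
   [2 ^ #|V| * A ^ d] makes [B ^ d.+1] exceed this count. *)
pose C := (\max_(i < d.+1) msize (y i : S))%N; pose A := (d.+1 * C).+1.
pose B := (2 ^ #|V| * A ^ d).+1; pose b := (d.+1 * (B * C))%N.
pose E := ({set V} * {ffun 'I_d -> 'I_b.+1})%type : finType.
pose M := \matrix_(i < #|digits B d.+1|, j < #|E|)
  (digit_monomial y (enum_val i))@_(off_monomial (enum_val j)).
have [|u nz_u uM] := left_kernel M.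
  rewrite card_digits card_prod card_ffun !card_ord -[#|{set V}|]cardsT.
  rewrite -powersetT card_powerset cardsT.
  have leb : (b.+1 <= A * B)%N.
    by rewrite /b /A [(_.+1 * B)%N]mulSn mulnA mulnAC -[X in (X <= _)%N]add1n leq_add2r.
  have le : (b.+1 ^ d <= (A * B) ^ d)%N.
    by case: (posnP d) => [->|d_gt0]; rewrite ?expn0 // leq_exp2r.
  have := leq_mul (leqnn (2 ^ #|V|)) le => /leq_ltn_trans; apply.
  rewrite expnMn mulnA expnS ltn_pmul2r ?expn_gt0 //.
pose c x := u 0 (enum_rank x).
have c0 : forall x, c x = 0.
  apply: (digit_monomial_indep ch); apply: JI; apply/facet_ideal_dualP => m.
  set p := \sum_x _ => mp; apply/forall_inP=> F DF; apply: contraT => nF.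
  have degm : (mdeg m <= b)%N.
    rewrite -ltnS; apply: leq_trans (msize_mdeg_lt mp) _.
    apply: (leq_trans (msize_sum _ _ _)); apply/bigmax_leqP => x _.
    apply: leq_trans (msizeZ_le _ _) _; apply: msize_digit_monomial => i lti.
    by apply: leqW; apply: (leq_bigmax (F := fun i : 'I_d.+1 => msize (y i)) (Ordinal lti)).
  have [g Dm] := off_monomialP DF nF degm.
  suff pm0 : p@_m = 0 by rewrite mcoeff_msupp pm0 eqxx in mp.
  have /rowP/(_ (enum_rank ((F, g) : E))) := uM; rewrite !mxE => <-.
  rewrite /p linear_sum (reindex (@enum_val (digits B d.+1) xpredT)) /=; last first.
    by exists enum_rank => x _; rewrite ?enum_rankK ?enum_valK.
  apply: eq_bigr => i _; rewrite linearZ /= /c enum_valK mxE enum_rankK -Dm.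
  by [].
case/negP: nz_u; apply/eqP/rowP=> i; rewrite mxE.
by have := c0 (enum_val i); rewrite /c enum_valK.
Qed.

End DimensionBound.

(** * Cohen-Macaulayness of facet ideal duals *)

Section CohenMacaulay.
Variables (K : fieldType) (V : finType) (D : {set {set V}}) (F0 : {set V}).
Hypotheses (DF0 : F0 \in facets D).
Hypothesis minF0 : forall F, F \in facets D -> (#|F0| <= #|F|)%N.
Local Notation S := {mpoly K[#|V|]}.
Local Notation J := (@facet_ideal_dual K V D).
Local Notation d := (#|V| - #|F0|)%N.

Let iJ : is_ideal J := facet_ideal_dual_ideal K D.

Let codim F : F \in facets D -> (#|~: F| <= d)%N.
Proof. by move=> DF; rewrite -(cardsC F) addnC -addnBA ?leq_addr ?minF0. Qed.

(** An element outside the prime [P i] is a non-zero-divisor modulo it, so the witnesses of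
    strictness form an [nzd_chain]. *)
Lemma prime_chain_le l P : prime_chain J l P -> (l <= d)%N.
Proof.
case=> prP JP0 strict; rewrite leqNgt; apply/negP => ltdl.
have [y yP] : exists y : nat -> S, forall i, (i < l)%N -> y i \in P i.+1 /\ y i \notin P i.
  apply: (choice_fun (P := fun i (y : S) => (i < l)%N -> y \in P i.+1 /\ y \notin P i)) => i.
  case: (ltnP i l) => [lt|_]; last by exists 0.
  by have [_ [p p1 p0]] := strict i lt; exists p.
apply: (nzd_chain_bound codim (I := fun i p => p \in P i) (y := y) JP0).
split=> [i lei||i lti].
- have [[P0 _ PD] _] := prP i (leq_trans lei ltdl).
  have PM c p : p \in P i -> c * p \in P i.
    by move=> Pp; rewrite -[c * p]addr0; apply: PD.
  by split=> // a b Pa Pb; rewrite -[a]mul1r; apply: PD.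
- by have [[_ /negP ]] := prP _ ltdl.
- have ltl := leq_trans lti ltdl; have [yP1 yP0] := yP i ltl.
  split=> // [p yp|p]; last by have [sub _] := strict i ltl; apply: sub.
  have [_ pr] := prP i (ltnW ltl).
  by have := pr _ _ yp; rewrite (negbTE yP0).
Qed.

(** The partial ideals form the chain; cut off after [d.+1] terms, it ends in an ideal contained in
    the full one, hence proper. *)
Lemma regular_sequence_le s : regular_sequence J s -> (size s <= d)%N.
Proof.
rewrite regular_sequence_foldl // => -[reg proper]; rewrite leqNgt; apply/negP => ltds.
apply: (nzd_chain_bound codim (I := fun i => foldl (@ideal_adj S) J (take i s))
  (y := nth 0 s)) => [p|]; first by rewrite take0.
have iI i : is_ideal (foldl (@ideal_adj S) J (take i s)) by apply: foldl_adj_ideal.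
split=> // [I1|i lti].
  apply: proper; rewrite -[s](cat_take_drop d.+1) foldl_cat.
  elim: (drop _ _) (foldl _ _ _) I1 => //= f s' IHs I I1.
  exact/IHs/ideal_adj_sub.
have lts := leq_trans lti ltds; split; first exact: reg.
  by rewrite (take_nth 0) // foldl_rcons; apply: ideal_adj_mem.
by move=> p Ip; rewrite (take_nth 0) // foldl_rcons; apply: ideal_adj_sub.
Qed.

Lemma facet_krull_dim : has_krull_dim J d.
Proof. by split=> [|l P]; [apply: facet_chain | apply: prime_chain_le]. Qed.

(** No regular sequence is longer than [d], the Krull dimension, so a single one attaining it is
    enough. *)
Lemma cohen_macaulay_regular : cohen_macaulay J <->
  exists s, [/\ size s = d, forall f, f \in s -> irrelevant_ideal f & regular_sequence J s].
Proof.
split=> [[t [[s [reg ms] szs] _] [[P chP] maxt]]|[s [szs ms reg]]].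
  exists s; split=> //; rewrite szs; apply/eqP; rewrite eqn_leq (prime_chain_le chP).
  by have [P' chP'] := facet_chain K DF0; apply: maxt chP'.
exists d; last exact: facet_krull_dim.
by split=> [|f [/regular_sequence_le]//]; exists s.
Qed.

Lemma cohen_macaulay_rank r aug d' : @resolution K #|V| J r aug d' ->
  cohen_macaulay J <-> forall i, (#|F0| < i)%N -> r i = 0%N.
Proof.
move=> R; have leF0 : (#|F0| <= #|V|)%N by apply: max_card.
rewrite cohen_macaulay_regular; split=> [[s [szs ms]]|r0].
  rewrite regular_sequence_rseq // => reg i lti; apply/eqP/negPn/negP => /eqP nz.
  have := rseq_length iJ R nz ms reg; rewrite szs; lia.
have [||s [szs ms reg]] := rseq_exists (t := d) iJ _ R r0 _.
- by move=> q; apply: facet_ideal_dual_irrelevant DF0.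
- by rewrite subnKC.
by exists s; split=> //; apply/regular_sequence_rseq.
Qed.

End CohenMacaulay.

(** The epsilon picks a rank realised by some graded resolution, and uniqueness of ranks identifies
    it with [r i]. *)
Lemma betti_eq (K : fieldType) (n : nat) (J : {mpoly K[n]} -> Prop) r deg aug d i :
  is_ideal J -> @minimal_graded_resolution K n J r deg aug d -> betti J i = r i.
Proof.
move=> iJ R; rewrite /betti.
have := epsilon_spec (inhabits 0%N) (has_betti J i).
case=> [|r' [deg' [aug' [d' [R' <-]]]]]; first by exists (r i), r, deg, aug, d.
exact: resolution_rank_eq iJ _ _ _ _ _ _ i (mgr_resolution R') (mgr_resolution R).
Qed.

Lemma facets_min (V : finType) (D : {set {set V}}) : is_complex D ->
  exists2 F0, F0 \in facets D & forall F, F \in facets D -> (#|F0| <= #|F|)%N.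
Proof.
case=> D0 _; have [F maxF _] := maxset_exists (D0 : mem D set0).
have DF : F \in facets D by rewrite inE.
by case: (arg_minnP (fun F : {set V} => #|F|) DF) => F0 DF0 minF0; exists F0.
Qed.

(** * Facets of the expansion and divisibility by the products u_i *)

Section Expansion.
Variables (n : nat) (k : 'I_n -> nat) (D : {set {set 'I_n}}).
Hypothesis k_gt0 : forall i, (0 < k i)%N.

(** The index map fed to [spread]. Variables of a polynomial ring are numbered by the cardinal of
    their type, so even those of the original complex pass through [enum_rank]. *)
Definition tag_rank (y : 'I_#|expvar k|) : 'I_#|{: 'I_n}| := enum_rank (tag (enum_val y)).

Lemma tag_rank_surj i : exists y, tag_rank y = i.
Proof.
pose x : expvar k := Tagged (fun i => 'I_(k i)) (Ordinal (k_gt0 (enum_val i))).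
by exists (enum_rank x); rewrite /tag_rank enum_rankK enum_valK.
Qed.

Lemma card_expansion_facet G : G \in expansion_facets k D ->
  [set tag x | x in G] \in facets D /\ #|[set tag x | x in G]| = #|G|.
Proof. by rewrite inE => /andP[/dinjectiveP injG DF]; rewrite card_in_imset. Qed.

Lemma section_facet (u : 'I_n -> expvar k) F : cancel u tag -> F \in facets D ->
  u @: F \in expansion_facets k D /\ #|u @: F| = #|F|.
Proof.
move=> uK DF; rewrite card_imset; last exact: can_inj uK.
rewrite inE -imset_comp (eq_imset _ uK) imset_id DF andbT; split=> //.
by apply/dinjectiveP=> x y /imsetP[i _ ->] /imsetP[j _ ->]; rewrite !uK => ->.
Qed.

(** For each i pick the x_ij of least exponent in [m]: the resulting transversal of [F] is hit only
    if some u_i with i in [F] divides [m]. Conversely, such a u_i has a factor in every transversal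
    of [F]. *)
Lemma facet_hits_expansion m : facet_hits (expansion k D) m = facet_hits D (lowm tag_rank m).
Proof.
rewrite /facet_hits facets_expansion; apply/forall_inP/forall_inP=> [hm F DF|hm G].
  apply: contraT => nF.
  have low i : exists x : expvar k,
      tag x = i /\ lowm tag_rank m (enum_rank i) = m (enum_rank x).
    have [y Dy ->] := lowm_attained tag_rank_surj m (enum_rank i).
    by exists (enum_val y); rewrite enum_valK; split=> //; apply: enum_rank_inj.
  have [u uP] := choice_fun low.
  have [EG _] := section_facet (fun i => (uP i).1) DF.
  have /exists_inP[_ /imsetP[i Fi ->] nz] := hm _ EG.
  case/negP: nF; apply/exists_inP; exists i => //.
  by rewrite (uP i).2.
move=> EG; have [DF _] := card_expansion_facet EG.
have /exists_inP[_ /imsetP[x Gx ->] nz] := hm _ DF.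
apply/exists_inP; exists x => //; rewrite -lt0n in nz; rewrite -lt0n; apply: (leq_trans nz).
have := lowm_le tag_rank m (enum_rank x).
by rewrite /tag_rank enum_rankK.
Qed.

Lemma expansion_facets_min F0 : F0 \in facets D ->
  (forall F, F \in facets D -> (#|F0| <= #|F|)%N) ->
  exists G0, [/\ G0 \in facets (expansion k D), #|G0| = #|F0| &
    forall G, G \in facets (expansion k D) -> (#|G0| <= #|G|)%N].
Proof.
move=> DF0 minF0; pose u i : expvar k := Tagged (fun i => 'I_(k i)) (Ordinal (k_gt0 i)).
have [EG0 szG0] := section_facet (u := u) (fun i => erefl) DF0.
exists (u @: F0); rewrite facets_expansion szG0; split=> // G /card_expansion_facet.
by case=> DG <-; apply: minF0.
Qed.

End Expansion.

Theorem proposition1p1 (K : fieldType) (n : nat) (Delta : {set {set 'I_n}})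
    (k : 'I_n -> nat) (hDelta : is_complex Delta)
    (hk : forall i, (0 < k i)%N) :
  let J := @facet_ideal_dual K 'I_n Delta in
  let Jexp := @facet_ideal_dual K (expvar k) (expansion k Delta) in
  (forall i : nat, betti J i = betti Jexp i) /\
  (cohen_macaulay J <-> cohen_macaulay Jexp).
Proof.
move=> J Jexp.
have iJ : is_ideal J := facet_ideal_dual_ideal K Delta.
have iJexp : is_ideal Jexp := facet_ideal_dual_ideal K (expansion k Delta).
have [F0 DF0 minF0] := facets_min hDelta.
have [G0 [EG0 szG0 minG0]] := expansion_facets_min hk DF0 minF0.
have [r [deg [aug [d R]]]] := graded_resolution_exists iJ
  (fun p => facet_ideal_dual_irrelevant DF0) (@facet_ideal_dual_pihomog _ _ _).
(* [betti Jexp] is chosen among ranks of graded resolutions, so one must exist; [RS] below carries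
   no grading. *)
have [r' [deg' [aug' [d' R']]]] := graded_resolution_exists iJexp
  (fun p => facet_ideal_dual_irrelevant EG0) (@facet_ideal_dual_pihomog _ _ _).
have JexpP p : Jexp p <->
    forall m, m \in msupp p -> facet_hits Delta (lowm (@tag_rank n k) m).
  rewrite /Jexp facet_ideal_dualP; split=> h m /h; by rewrite facet_hits_expansion.
have RS := spread_resolution (tag_rank_surj hk) iJ iJexp (@facet_ideal_dualP _ _ _)
  JexpP (mgr_resolution R).
split=> [i|].
  rewrite (betti_eq i iJ R) (betti_eq i iJexp R').
  exact: resolution_rank_eq iJexp _ _ _ _ _ _ i RS (mgr_resolution R').
rewrite (cohen_macaulay_rank DF0 minF0 (mgr_resolution R)).
by rewrite (cohen_macaulay_rank EG0 minG0 RS) szG0.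
Qed.
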